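(* Let $m\ge1$, $0<q<1$. The Hilbert completion $\mathscr H_q^{(m)}$ of $\mathscr P_m$ for the Jackson–Fischer inner product is a reproducing-kernel Hilbert space of $\bigwedge\mathbb C^m$-valued holomorphic functions on $$\Omega_q=\{(z,w)\in\mathbb C^{2m}:|z_i|<(1-q)^{-1/2},\ |w_i|<(1-q)^{-1/2}\ \text{for all }i\}$$ with kernel $$K_q((z,w),(\zeta,\omega))=\prod_{i=1}^m\mathrm e_q(z_i\overline{\zeta_i})\,\mathrm e_q(w_i\overline{\omega_i})\,I_{\bigwedge\mathbb C^m}.$$ The four operators $\mathcal D_q,\mathcal D_q^\dagger,\mathcal Z,\mathcal Z^\dagger$ extend boundedly to $\mathscr H_q^{(m)}$. The generalized inverses $A_q^\#,B_q^\#$ and the four Fischer projectors $\Pi_z,Q_z,\Pi_w,Q_w$ also extend boundedly, and $\ker\mathcal D_q$, $\ker\mathcal D_q^\dagger$ and $\ker\mathcal D_q\cap\ker\mathcal D_q^\dagger$ are closed subspaces of $\mathscr H_q^{(m)}$.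
   Context: $[r]_q=\frac{1-q^r}{1-q}$, $[r]_q!=\prod_{k=1}^r[k]_q$, $[\alpha]_q!=\prod_i[\alpha_i]_q!$, $\mathrm e_q(t)=\sum_{r\ge0}t^r/[r]_q!$. $\mathscr P_m=\mathbb C[z_1,\dots,z_m,w_1,\dots,w_m]\otimes\bigwedge\mathbb C^m$ with basis $z^\alpha w^\beta e_S$ ($\alpha,\beta\in\mathbb N_0^m$, $S\subseteq\{1,\dots,m\}$). The Jackson–Fischer inner product makes this basis orthogonal with $\|z^\alpha w^\beta e_S\|^2=[\alpha]_q!\,[\beta]_q!$. $D_{q,x}f=\frac{f(\dots,qx,\dots)-f(\dots,x,\dots)}{(q-1)x}$; $\varepsilon_i$ is exterior multiplication by the $i$-th basis vector, $\iota_i=\varepsilon_i^*$ contraction. $\mathcal D_q=\sum_i\varepsilon_iD_{q,z_i}$, $\mathcal D_q^\dagger=\sum_i\iota_iD_{q,w_i}$, $\mathcal Z=\sum_i\iota_iz_i$, $\mathcal Z^\dagger=\sum_i\varepsilon_iw_i$. $A_q=\mathcal D_q\mathcal Z+\mathcal Z\mathcal D_q$ and $B_q=\mathcal D_q^\dagger\mathcal Z^\dagger+\mathcal Z^\dagger\mathcal D_q^\dagger$ are diagonal in the basis with eigenvalues $\sum_i[\alpha_i+\mathbf 1_{i\in S}]_q$ and $\sum_i[\beta_i+1-\mathbf 1_{i\in S}]_q$; $A_q^\#,B_q^\#$ invert the positive eigenvalues and keep eigenvalue zero as zero. $Q_z=\mathcal ZA_q^\#\mathcal D_q$, $\Pi_z=I-Q_z$,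 $Q_w=\mathcal Z^\dagger B_q^\#\mathcal D_q^\dagger$, $\Pi_w=I-Q_w$. Operator-valued reproducing kernel: $K(\cdot,y)v\in\mathscr H$ and $\langle f,K(\cdot,y)v\rangle=\langle f(y),v\rangle$ for all $f\in\mathscr H$, $y\in\Omega_q$, $v\in\bigwedge\mathbb C^m$ (inner products linear in the first argument). *)

(* Defs.v *)
From HB Require Import structures.
From mathcomp Require Import all_boot all_order all_algebra.
From mathcomp Require Import complex.
From mathcomp Require Import all_classical all_reals all_analysis.
From mathcomp Require Import -(notations) mpoly.
Set Implicit Arguments. Unset Strict Implicit. Unset Printing Implicit Defensive.
Import Order.TTheory GRing.Theory Num.Theory.
Import numFieldNormedType.Exports.
Local Open Scope classical_set_scope.
Local Open Scope ring_scope.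

(* The complex numbers, with the structure that makes the topology and the norm
   of a numClosedFieldType available. *)
Definition CC (R : realType) : numClosedFieldType := R[i].

(* Elements of P_m, as families indexed by S of coefficients of e_S; the
   variable z_i is 'X_(lshift m i), the variable w_i is 'X_(rshift m i). *)
Notation fpoly R m := {ffun {set 'I_m} -> mpoly (m + m) (CC R)}.

(* The exterior algebra of C^m, in the basis e_S = e_{s_1} /\ ... /\ e_{s_k},
   S = {s_1 < ... < s_k}. *)
Notation extalg R m := {ffun {set 'I_m} -> CC R}.

Notation point R m := ('rV[CC R]_m * 'rV[CC R]_m)%type.

Definition toC (R : realType) (x : R) : CC R := x%:C%C.

Section QNumbers.
Variables (R : realType) (q : R).

Definition qnat (n : nat) : R := (1 - q ^+ n) / (1 - q).

Definition qfact (n : nat) : R := \prod_(1 <= k < n.+1) qnat k.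

Definition qexp (t : CC R) : CC R :=
  limn (series (fun n => t ^+ n / toC (qfact n))).

End QNumbers.

Section ScalarOperators.
Variables (R : realType) (n : nat) (q : R) (i : 'I_n).
Implicit Types p : mpoly n (CC R).

Definition dilate p : mpoly n (CC R) :=
  comp_mpoly
    [tuple (if j == i then toC q *: mpolyX (CC R) (mnm1 j)
            else mpolyX (CC R) (mnm1 j)) | j < n] p.

(* Exact division by 'X_i, for p divisible by 'X_i. *)
Definition divX p : mpoly n (CC R) :=
  \sum_(a <- msupp p) mcoeff a p *: mpolyX (CC R) (mnm_sub a (mnm1 i)).

Definition qderiv p : mpoly n (CC R) :=
  divX ((toC (q - 1))^-1 *: (dilate p - p)).

End ScalarOperators.

Section Exterior.
Variables (R : realType) (m : nat) (V : lmodType (CC R)).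
Implicit Types (f : {ffun {set 'I_m} -> V}) (i : 'I_m).

Definition esgn i (S : {set 'I_m}) : CC R :=
  (-1) ^+ #|[set j in S | (j < i)%N]|.

Definition ext_mul i f : {ffun {set 'I_m} -> V} :=
  [ffun S : {set 'I_m} => if i \in S then esgn i S *: f (S :\ i) else 0].

Definition ext_ctr i f : {ffun {set 'I_m} -> V} :=
  [ffun S : {set 'I_m} => if i \in S then 0 else esgn i S *: f (i |: S)].

End Exterior.

Definition ext_dot (R : realType) (m : nat) (u v : extalg R m) : CC R :=
  \sum_S u S * (v S)^*%R.

Section Operators.
Variables (R : realType) (m : nat) (q : R).
Implicit Types (f g : fpoly R m) (a : multinom (m + m)).

Definition coefw (T : mpoly (m + m) (CC R) -> mpoly (m + m) (CC R)) f
  : fpoly R m := [ffun S => T (f S)].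

Definition zvar (i : 'I_m) : mpoly (m + m) (CC R) :=
  mpolyX (CC R) (mnm1 (lshift m i)).
Definition wvar (i : 'I_m) : mpoly (m + m) (CC R) :=
  mpolyX (CC R) (mnm1 (rshift m i)).

Definition Dq f : fpoly R m :=
  \sum_i ext_mul i (coefw (qderiv q (lshift m i)) f).
Definition Dqdag f : fpoly R m :=
  \sum_i ext_ctr i (coefw (qderiv q (rshift m i)) f).
Definition Zop f : fpoly R m := \sum_i ext_ctr i (coefw ( *%R (zvar i)) f).
Definition Zdag f : fpoly R m := \sum_i ext_mul i (coefw ( *%R (wvar i)) f).

Definition Aq f : fpoly R m := Dq (Zop f) + Zop (Dq f).
Definition Bq f : fpoly R m := Dqdag (Zdag f) + Zdag (Dqdag f).

(* The spectral decompositions Aq = diagop Aeig and Bq = diagop Beig are AqE and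
   BqE below; diagop lam has eigenvalue lam S a on z^alpha w^beta e_S, where
   a = (alpha, beta). *)
Definition diagop (lam : {set 'I_m} -> multinom (m + m) -> R) f : fpoly R m :=
  [ffun S : {set 'I_m} => \sum_(a <- msupp (f S))
     (toC (lam S a) * mcoeff a (f S)) *: mpolyX (CC R) a].

Definition Aeig (S : {set 'I_m}) a : R :=
  \sum_(i < m) qnat q (a (lshift m i) + (i \in S)).
Definition Beig (S : {set 'I_m}) a : R :=
  \sum_(i < m) qnat q ((a (rshift m i)).+1 - (i \in S)).

(* Zero eigenvalues are kept, since 0^-1 = 0. *)
Definition Apinv : fpoly R m -> fpoly R m := diagop (fun S a => (Aeig S a)^-1).
Definition Bpinv : fpoly R m -> fpoly R m := diagop (fun S a => (Beig S a)^-1).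

Definition Qz f : fpoly R m := Zop (Apinv (Dq f)).
Definition Piz f : fpoly R m := f - Qz f.
Definition Qw f : fpoly R m := Zdag (Bpinv (Dqdag f)).
Definition Piw f : fpoly R m := f - Qw f.

Definition jf_weight a : R :=
  (\prod_(i < m) qfact q (a (lshift m i))) *
  (\prod_(i < m) qfact q (a (rshift m i))).

Definition jf_dot f g : CC R :=
  \sum_S \sum_(a <- msupp (f S))
    mcoeff a (f S) * (mcoeff a (g S))^*%R * toC (jf_weight a).

Definition peval f (x : point R m) : extalg R m :=
  [ffun S => meval (fun k => row_mx x.1 x.2 0 k) (f S)].

Definition Omega : set (point R m) :=
  [set x : point R m | forall i : 'I_m,
     `|x.1 0 i| < toC (Num.sqrt (1 - q))^-1 /\
     `|x.2 0 i| < toC (Num.sqrt (1 - q))^-1].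

(* The scalar factor of the kernel, which is a multiple of the identity. *)
Definition Kq (x y : point R m) : CC R :=
  \prod_(i < m) (qexp q (x.1 0 i * (y.1 0 i)^*%R) *
                 qexp q (x.2 0 i * (y.2 0 i)^*%R)).

End Operators.

(* A Hilbert space (complete, with norm induced by a form that is linear in its
   first argument) together with a linear isometry of P_m onto a dense subspace. *)
Record hilbert_completion (R : realType) (m : nat) (q : R) :=
  HilbertCompletion {
    hc_space :> completeNormedModType (CC R);
    hc_dot : {dot hc_space for Num.conj};
    hc_norm : forall x : hc_space, `|x| ^+ 2 = hc_dot x x;
    hc_emb : {linear fpoly R m -> hc_space};
    hc_isom : forall f g : fpoly R m,
      hc_dot (hc_emb f) (hc_emb g) = jf_dot q f g;
    hc_dense : dense (range hc_emb) }.

(* Complex differentiability: differentiable is taken over the field CC R. *)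
Definition holomorphic_on (R : realType) (m : nat) (D : set (point R m))
    (F : point R m -> extalg R m) : Prop :=
  forall S x, D x -> differentiable (fun y => F y S) x.

Section Completion.
Variables (R : realType) (m : nat) (q : R) (H : hilbert_completion m q).

(* ev realizes the elements of H as functions; only values on Omega matter. *)
Definition is_rkhs_of_holomorphic_functions : Prop :=
  exists ev : H -> point R m -> extalg R m,
  [/\ forall x, Omega q x -> linear (ev ^~ x),
      forall f g, (forall x, Omega q x -> ev f x = ev g x) -> f = g,
      forall p x, Omega q x -> ev (hc_emb H p) x = peval p x,
      forall f, holomorphic_on (Omega q) (ev f)
    & forall y (v : extalg R m), Omega q y ->
        exists k : H,
          (forall x, Omega q x -> ev k x = Kq q x y *: v) /\
          (forall f, hc_dot H f k = ext_dot (ev f y) v)].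

Definition bounded_extension (T : fpoly R m -> fpoly R m)
    (That : {linear H -> H}) : Prop :=
  (exists M : R, forall x, `|That x| <= toC M * `|x|) /\
  (forall p, That (hc_emb H p) = hc_emb H (T p)).

Definition extends_boundedly (T : fpoly R m -> fpoly R m) : Prop :=
  exists That : {linear H -> H}, bounded_extension T That.

Definition closed_subspace (E : set H) : Prop :=
  [/\ E 0, forall (c : CC R) x y, E x -> E y -> E (c *: x + y) & closed E].

Definition opker (T : {linear H -> H}) : set H := [set x | T x = 0].

End Completion.

Section Facts.
Variables (R : realType) (q : R).

Lemma toCE : @toC R =1 real_complex R. Proof. by []. Qed.

Section One.
Variables (n : nat) (i : 'I_n).
Implicit Types (p : mpoly n (CC R)) (a : multinom n).

Lemma mcoeff_dilate p a :
  mcoeff a (dilate q i p) = toC q ^+ a i * mcoeff a p.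
Proof.
have dilX b : dilate q i (mpolyX (CC R) b) = toC q ^+ b i *: mpolyX (CC R) b.
  rewrite /dilate comp_mpolyX (eq_bigr (fun j : 'I_n =>
     (if j == i then toC q ^+ b i else 1) *: mpolyX (CC R) (mnm1 j) ^+ b j)).
    rewrite scaler_prod -big_mkcond big_pred1_eq; congr (_ *: _).
    by rewrite [RHS]mpolyXE_id.
  by move=> j _; rewrite tnth_mktuple; case: eqP => [->|]; rewrite ?exprZn ?scale1r.
rewrite [in LHS](mpolyE p) /dilate [comp_mpoly _ _]raddf_sum [LHS]raddf_sum.
rewrite [in RHS](mpolyE p) [mcoeff a (\sum_(_ <- _) _)]raddf_sum mulr_sumr.
apply: eq_bigr => b _; rewrite /= comp_mpolyZ -/(dilate q i _) dilX.
rewrite !mcoeffZ !mcoeffX mulrCA; case: eqP => [->//|_]; by rewrite !mulr0.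
Qed.

Lemma mcoeff_divX p a :
  (forall b : multinom n, b i = 0%N -> mcoeff b p = 0) ->
  mcoeff a (divX i p) = mcoeff (mnm_add a (mnm1 i)) p.
Proof.
move=> p0; rewrite [in RHS](mpolyE p) /divX !raddf_sum /=.
apply: eq_bigr => b _; rewrite !mcoeffZ !mcoeffX.
case: (posnP (b i)) => [/p0->|bi]; first by rewrite !mul0r.
congr (_ * (nat_of_bool _)%:R); apply/eqP/eqP => [<-|->].
  apply/mnmP => j; rewrite mnmDE mnmBE mnm1E.
  by case: eqP => [<-|_]; [rewrite subnK | rewrite subn0 addn0].
by apply/mnmP => j; rewrite mnmBE mnmDE addnK.
Qed.

Lemma mcoeff_qderiv p a : q < 1 ->
  mcoeff a (qderiv q i p) =
  toC (qnat q (a i).+1) * mcoeff (mnm_add a (mnm1 i)) p.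
Proof.
move=> q1; have q0 : toC (q - 1) != 0.
  by rewrite toCE fmorph_eq0 subr_eq0 (lt_eqF q1).
rewrite /qderiv mcoeff_divX => [|b bi]; last first.
  by rewrite mcoeffZ mcoeffB mcoeff_dilate bi mul1r subrr mulr0.
rewrite mcoeffZ mcoeffB mcoeff_dilate mnmDE mnm1E eqxx addn1.
rewrite -{2}[mcoeff _ p]mul1r -mulrBl mulrA; congr (_ * _).
rewrite /qnat !toCE -[1 - q]opprB -[1 - _ ^+ _]opprB invrN mulrNN rmorphM.
by rewrite fmorphV mulrC; congr (_ * _); rewrite rmorphB rmorphXn rmorph1.
Qed.

Lemma mcoeffXmul p a : 
  mcoeff a (mpolyX (CC R) (mnm1 i) * p) =
  if a i == 0%N then 0 else mcoeff (mnm_sub a (mnm1 i)) p.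
Proof.
rewrite mulrC [in LHS](mpolyE p) mulr_suml raddf_sum /=.
case: ifPn => [ai|ai].
  apply: big1 => b _; rewrite -scalerAl -mpolyXD mcoeffZ mcoeffX.
  case: eqP => [E|]; rewrite ?mulr0 //.
  by move: ai; rewrite -E mnmDE mnm1E eqxx addn1.
rewrite [in RHS](mpolyE p) raddf_sum /=; apply: eq_bigr => b _.
rewrite -scalerAl -mpolyXD !mcoeffZ !mcoeffX.
congr (_ * (nat_of_bool _)%:R); apply/eqP/eqP => [<-|->].
  by apply/mnmP => j; rewrite mnmBE mnmDE addnK.
apply/mnmP => j; rewrite mnmDE mnmBE mnm1E.
by case: eqP => [<-|_]; [rewrite subnK ?lt0n | rewrite subn0 addn0].
Qed.

End One.

Section Ext.
Variables (m : nat).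

Lemma esgnK (i : 'I_m) S : esgn R i S * esgn R i S = 1.
Proof. by rewrite /esgn -expr2 -exprM mulnC exprM sqrrN !expr1n. Qed.

Lemma esgnU (i j : 'I_m) (S : {set 'I_m}) : j \notin S ->
  esgn R i (j |: S) = (-1) ^+ (j < i)%N * esgn R i S.
Proof.
move=> jS; rewrite /esgn -exprD; congr (_ ^+ _).
case: (ltnP j i) => ji.
  rewrite (_ : [set k in j |: S | (k < i)%N] = j |: [set k in S | (k < i)%N]).
    by rewrite cardsU1 inE (negPf jS).
  by apply/finset.setP => k; rewrite !inE andb_orl; case: eqP => [->|]; rewrite ?ji.
rewrite add0n; congr #|pred_of_set _|; apply/finset.setP => k; rewrite !inE andb_orl.
by case: eqP => [->|//]; rewrite ltnNge ji /= andbF.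
Qed.

Lemma ext_mul_ctr (V : lmodType (CC R)) (i j : 'I_m)
    (f : {ffun {set 'I_m} -> V}) :
  ext_mul i (ext_ctr j f) + ext_ctr j (ext_mul i f) =
  if i == j then f else 0.
Proof.
apply/ffunP => S; rewrite !ffunE !inE.
case: (eqVneq i j) => [<-|ij].
  case: ifPn => iS; rewrite ?ffunE ?finset.setD11 ?finset.setU11 scalerA.
    rewrite finset.setD1K // addr0 -[S in esgn R i S * _](finset.setD1K iS) esgnU ?finset.setD11 //.
    by rewrite ltnn mul1r esgnK scale1r.
  by rewrite finset.setU1K // add0r esgnU // ltnn mul1r esgnK scale1r.
rewrite /=.
have [iS|iS] := boolP (i \in S); have [jS|jS] := boolP (j \in S);
  rewrite ?scaler0 ?addr0 ?ffunE //.
have -> : (j |: S) :\ i = j |: (S :\ i).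
  by apply/finset.setP => k; rewrite !inE; case: eqP => // ->; rewrite (negPf ij).
have jSi : esgn R j S = (-1) ^+ (i < j)%N * esgn R j (S :\ i).
  by rewrite -[S in LHS](finset.setD1K iS) esgnU // !inE eqxx.
rewrite !scalerA -scalerDl esgnU // jSi.
have := ij; rewrite -val_eqE /= neq_ltn.
by case: (ltngtP (i : nat) j) => //= _ _; rewrite !(expr0, expr1, mul1r, mulN1r, mulrN, mulNr) mulrC (addNr, subrr) scale0r.
Qed.

Lemma ext_dot_adj i (u v : extalg R m) :
  ext_dot (ext_mul i u) v = ext_dot u (ext_ctr i v).
Proof.
rewrite /ext_dot (bigID (fun S : {set 'I_m} => i \in S)) /= [X in _ + X]big1 ?addr0; last first.
  by move=> S /negPf iS; rewrite ffunE iS mul0r.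
rewrite [RHS](bigID (fun S : {set 'I_m} => i \in S)) /= [X in X + _]big1 ?add0r; last first.
  by move=> S iS; rewrite ffunE iS rmorph0 mulr0.
rewrite (reindex_onto (fun S : {set 'I_m} => i |: S) (fun S : {set 'I_m} => S :\ i)) /=; last first.
  by move=> S iS; rewrite finset.setD1K.
apply: eq_big => [S|S].
  rewrite finset.setU11 /=; apply/eqP/idP => [<-|iS]; last by rewrite finset.setU1K.
  by rewrite !inE eqxx.
case/andP => _ /eqP SE; rewrite !ffunE finset.setU11 SE.
have iS : i \notin S by rewrite -SE !inE eqxx.
rewrite (negPf iS) esgnU // ltnn mul1r.
have sJ : (esgn R i S)^* = esgn R i S by rewrite /esgn rmorphXn rmorphN1.
have ZE (c d : CC R) : c *: (d : GRing.regular _) = c * d by [].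
by rewrite !ZE rmorphM /= sJ mulrCA mulrA.
Qed.

Lemma linear_sum' (U V : lmodType (CC R)) (g : U -> V) (I : finType) (F : I -> U) :
  linear g -> g (\sum_j F j) = \sum_j g (F j).
Proof.
move=> gl; have g0 : g 0 = 0.
  by have := gl (-1) 0 0; rewrite scaler0 addr0 scaleN1r addNr.
apply: big_morph => // x y; by have := gl 1 x y; rewrite !scale1r.
Qed.

Lemma ext_mul_lin (V : lmodType (CC R)) i : linear (@ext_mul R m V i).
Proof.
move=> c f g; apply/ffunP => S; rewrite !ffunE; case: ifP => _.
  by rewrite scalerDr !scalerA mulrC.
by rewrite scaler0 addr0.
Qed.

Lemma ext_ctr_lin (V : lmodType (CC R)) i : linear (@ext_ctr R m V i).
Proof.
move=> c f g; apply/ffunP => S; rewrite !ffunE; case: ifP => _.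
  by rewrite scaler0 addr0.
by rewrite scalerDr !scalerA mulrC.
Qed.

Section Coefw.
Variable (T : mpoly (m + m) (CC R) -> mpoly (m + m) (CC R)).
Hypothesis Tl : linear T.
Let TZ c p : T (c *: p) = c *: T p.
Proof.
have T0 : T 0 = 0.
  by have := Tl (-1) 0 0; rewrite scaler0 addr0 scaleN1r addNr.
by have := Tl c p 0; rewrite T0 !addr0.
Qed.
Let T0 : T 0 = 0. Proof. by have := TZ 0 0; rewrite !scale0r. Qed.

Lemma coefw_lin : linear (coefw T : fpoly R m -> fpoly R m).
Proof. by move=> c f g; apply/ffunP => S; rewrite !ffunE Tl. Qed.

Lemma coefw_mul i (f : fpoly R m) : coefw T (ext_mul i f) = ext_mul i (coefw T f).
Proof. by apply/ffunP => S; rewrite !ffunE; case: ifP; rewrite ?TZ. Qed.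

Lemma coefw_ctr i (f : fpoly R m) : coefw T (ext_ctr i f) = ext_ctr i (coefw T f).
Proof. by apply/ffunP => S; rewrite !ffunE; case: ifP; rewrite ?TZ. Qed.
End Coefw.

Lemma qderiv_lin n (i : 'I_n) : q < 1 -> linear (qderiv q i).
Proof.
move=> q1 c p p'; apply/mpolyP => a.
by rewrite mcoeffD mcoeffZ !mcoeff_qderiv // mcoeffD mcoeffZ mulrDr mulrCA.
Qed.

Lemma mul_lin n (p : mpoly n (CC R)) : linear ( *%R p).
Proof. by move=> c r s; rewrite mulrDr scalerAr. Qed.

Section Anti.
Variables (v : 'I_m -> 'I_(m + m)).
Hypotheses (q1 : q < 1) (vI : injective v).
Let d i := qderiv q (v i).
Let x i : mpoly (m + m) (CC R) -> _ := *%R (mpolyX (CC R) (mnm1 (v i))).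

Lemma qderiv_mulC i j p : i != j -> d i (x j p) = x j (d i p).
Proof.
move=> ij; apply/mpolyP => a; rewrite /d /x mcoeff_qderiv // !mcoeffXmul.
have vij : (v i == v j) = false by rewrite (inj_eq vI) (negPf ij).
rewrite mcoeff_qderiv // mnmDE mnm1E vij addn0.
case: ifP => [_|/negbT a0]; first by rewrite mulr0.
rewrite mnmBE mnm1E [v j == v i]eq_sym vij subn0; congr (_ * mcoeff _ _).
apply/mnmP => k; rewrite !(mnmBE, mnmDE, mnm1E).
case: (eqVneq (v j) k) => [<-|_]; last by rewrite !subn0.
by rewrite vij !addn0.
Qed.

Lemma anti_sum (A B : 'I_m -> fpoly R m -> fpoly R m) (f : fpoly R m) :
    (forall i, linear (A i)) -> (forall i, linear (B i)) ->
    (forall i j g, A i (B j g) + B j (A i g) = if i == j then g else 0) ->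
    (forall T, linear T -> forall i g, coefw T (A i g) = A i (coefw T g)) ->
    (forall T, linear T -> forall i g, coefw T (B i g) = B i (coefw T g)) ->
  \sum_i A i (coefw (d i) (\sum_j B j (coefw (x j) f))) +
  \sum_j B j (coefw (x j) (\sum_i A i (coefw (d i) f))) =
  \sum_i (A i (B i (coefw (d i) (coefw (x i) f))) +
          B i (A i (coefw (x i) (coefw (d i) f)))).
Proof.
move=> Al Bl AB TA TB.
have dl i : linear (d i) by exact: qderiv_lin.
have xl i : linear (x i) by exact: mul_lin.
rewrite (eq_bigr (fun i => \sum_j A i (B j (coefw (d i) (coefw (x j) f))))); last first.
  move=> i _; rewrite (linear_sum' _ (coefw_lin (dl i))) (linear_sum' _ (Al i)).
  by apply: eq_bigr => j _; rewrite TB.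
rewrite [X in _ + X](eq_bigr (fun j => \sum_i B j (A i (coefw (x j) (coefw (d i) f))))); last first.
  move=> i _; rewrite (linear_sum' _ (coefw_lin (xl i))) (linear_sum' _ (Bl i)).
  by apply: eq_bigr => j _; rewrite TA.
rewrite [X in _ + X]exchange_big -big_split; apply: eq_bigr => i _ /=.
rewrite -big_split /= (bigD1 i) //= big1 ?addr0 // => j ji.
have -> : coefw (d i) (coefw (x j) f) = coefw (x j) (coefw (d i) f).
  by apply/ffunP => S; rewrite !ffunE qderiv_mulC // eq_sym.
by rewrite AB eq_sym (negPf ji).
Qed.

Lemma mcoeff_dx i p a : mcoeff a (d i (x i p)) = toC (qnat q (a (v i)).+1) * mcoeff a p.
Proof.
rewrite mcoeff_qderiv // mcoeffXmul mnmDE mnm1E eqxx addn1 /=; congr (_ * mcoeff _ _).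
by apply/mnmP => k; rewrite mnmBE mnmDE addnK.
Qed.

Lemma mcoeff_xd i p a : mcoeff a (x i (d i p)) = toC (qnat q (a (v i))) * mcoeff a p.
Proof.
rewrite mcoeffXmul; case: (posnP (a (v i))) => [->|a0].
  by rewrite /qnat expr0 subrr mul0r /= mul0r.
rewrite mcoeff_qderiv // mnmBE mnm1E eqxx subn1 prednK //; congr (_ * mcoeff _ _).
apply/mnmP => k; rewrite mnmDE mnmBE mnm1E.
by case: eqP => [<-|_]; [rewrite subnK | rewrite subn0 addn0].
Qed.

Lemma ext_mul_ctr_diag (V : lmodType (CC R)) i (g : {ffun {set 'I_m} -> V}) S :
  ext_mul i (ext_ctr i g) S = if i \in S then g S else 0.
Proof.
rewrite !ffunE finset.setD11; case: ifP => // iS.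
rewrite finset.setD1K // scalerA -[S in esgn R i S * _](finset.setD1K iS).
by rewrite esgnU ?finset.setD11 // ltnn mul1r esgnK scale1r.
Qed.

Lemma ext_ctr_mul_diag (V : lmodType (CC R)) i (g : {ffun {set 'I_m} -> V}) S :
  ext_ctr i (ext_mul i g) S = if i \in S then 0 else g S.
Proof.
rewrite !ffunE finset.setU11; case: ifPn => // iS.
by rewrite finset.setU1K // scalerA esgnU // ltnn mul1r esgnK scale1r.
Qed.
End Anti.

Lemma mcoeff_diagop lam (f : fpoly R m) S a :
  mcoeff a (diagop lam f S) = toC (lam S a) * mcoeff a (f S).
Proof.
rewrite ffunE [in RHS](mpolyE (f S)) !raddf_sum /=  mulr_sumr.
apply: eq_bigr => b _; rewrite !mcoeffZ mcoeffX -mulrA.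
by case: eqP => [->//|_]; rewrite !mulr0.
Qed.

Lemma AqE (f : fpoly R m) : q < 1 -> Aq q f = diagop (Aeig q) f.
Proof.
move=> q1; rewrite /Aq /Dq /Zop.
rewrite (@anti_sum (@lshift m m) q1 (@lshift_inj m m) (@ext_mul R m _) (@ext_ctr R m _)); first last.
- by move=> T Tl i g; rewrite coefw_ctr.
- by move=> T Tl i g; rewrite coefw_mul.
- by move=> i j g; rewrite ext_mul_ctr.
- exact: ext_ctr_lin.
- exact: ext_mul_lin.
apply/ffunP => S; apply/mpolyP => a; rewrite mcoeff_diagop sum_ffunE raddf_sum /=.
rewrite /Aeig !toCE rmorph_sum mulr_suml; apply: eq_bigr => i _.
rewrite ffunE ext_mul_ctr_diag ext_ctr_mul_diag.
by case: (i \in S); rewrite ?addr0 ?add0r !ffunE ?mcoeff_dx ?mcoeff_xd // ?addn1 ?addn0.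
Qed.

Lemma BqE (f : fpoly R m) : q < 1 -> Bq q f = diagop (Beig q) f.
Proof.
move=> q1; rewrite /Bq /Dqdag /Zdag.
rewrite (@anti_sum (@rshift m m) q1 (@rshift_inj m m) (@ext_ctr R m _) (@ext_mul R m _)); first last.
- by move=> T Tl i g; rewrite coefw_mul.
- by move=> T Tl i g; rewrite coefw_ctr.
- by move=> i j g; rewrite addrC ext_mul_ctr eq_sym.
- exact: ext_mul_lin.
- exact: ext_ctr_lin.
apply/ffunP => S; apply/mpolyP => a; rewrite mcoeff_diagop sum_ffunE raddf_sum /=.
rewrite /Beig !toCE rmorph_sum mulr_suml; apply: eq_bigr => i _.
rewrite ffunE ext_mul_ctr_diag ext_ctr_mul_diag.
by case: (i \in S); rewrite ?addr0 ?add0r !ffunE ?mcoeff_dx ?mcoeff_xd // ?subn1 ?subn0.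
Qed.
End Ext.
End Facts.

(* Main.v *)
Require Import Defs.
From HB Require Import structures.
From mathcomp Require Import all_boot all_order all_algebra.
From mathcomp Require Import complex.
From mathcomp Require Import all_classical all_reals all_analysis.
From mathcomp Require Import -(notations) mpoly.
From mathcomp Require Import ring lra.
(* The completion is realized as the space of square-summable families indexed by
   the basis z^alpha w^beta e_S, so the first claim reduces to completeness of l^2.
   In any completion, each basic operator is a weighted shift in an orthogonal
   basis with bounded weights ([n]_q <= 1/(1-q), nonzero eigenvalues of A_q and B_q
   are >= 1), hence extends by density.
   On Omega_q the truncations of the kernel are Cauchy, because the q-exponential
   has radius of convergence 1/(1-q); their limits k_{x,S} give evaluation as
   f |-> <f, k_{x,S}>.  Functions are holomorphic because the second-order Taylor
   remainder of a polynomial is bounded, through the majorant with coefficients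
   replaced by their moduli, by its norm times a local constant, and such a bound
   passes to limits.  If all values of f vanish then so do those of D_{q,i} f, by
   the q-difference formula; since D_{q,i} is adjoint to multiplication by the i-th
   variable and the kernel at the origin is constant, induction on the degree shows
   that f is orthogonal to all monomials. *)

Set Implicit Arguments. Unset Strict Implicit. Unset Printing Implicit Defensive.
Import Order.TTheory GRing.Theory Num.Theory.
Import numFieldNormedType.Exports.
Local Open Scope classical_set_scope.
Local Open Scope ring_scope.

(** [hilbert_completion] is abstract: an element of [H] comes with neither coefficients nor values,
    only with the norm, the form and the dense image of the polynomials. Claims about [H] are
    therefore checked on [emb p] and carried over by an inequality, either along sequences
    ([extend_exists]) or within the class [bounded_form], where an estimate or an identity on
    polynomials holds everywhere. The Taylor remainder is treated in this way for each fixed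
    increment [h], where it is a bounded functional of the element, so limit and differentiation are
    never interchanged. That it is quadratic in [h] comes from scaling: the jet norm weights the
    part of order j by [T ^+ j], is submultiplicative, and is bounded independently of every
    [T >= 1] that keeps [T * h] in a fixed polydisc; taking [T] inversely proportional to the norm
    of [h] produces the square. Norms over [CC R] take complex values; [rnorm] is the real part, so
    that [lra], [nra] and suprema in [R] apply. *)

(** * Real-valued norms and completeness of the complex numbers *)

Section RealNorm.
Variable R : realType.
Implicit Types (V : normedModType (CC R)).

Lemma toC_le (x y : R) : (toC x <= toC y) = (x <= y).
Proof. exact: lecR. Qed.

Lemma toC_lt (x y : R) : (toC x < toC y) = (x < y).
Proof. exact: ltcR. Qed.

Lemma toC0 : toC 0 = 0 :> CC R. Proof. exact: rmorph0 (real_complex R). Qed.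
Lemma toC1 : toC 1 = 1 :> CC R. Proof. exact: rmorph1 (real_complex R). Qed.
Lemma toCD (x y : R) : toC (x + y) = toC x + toC y.
Proof. exact: rmorphD (real_complex R) x y. Qed.
Lemma toCM (x y : R) : toC (x * y) = toC x * toC y.
Proof. exact: rmorphM (real_complex R) x y. Qed.
Lemma toCN (x : R) : toC (- x) = - toC x.
Proof. exact: rmorphN (real_complex R) x. Qed.
Lemma toCV (x : R) : toC x^-1 = (toC x)^-1.
Proof. exact: fmorphV (real_complex R) x. Qed.
Lemma toCX (x : R) n : toC (x ^+ n) = toC x ^+ n.
Proof. exact: rmorphXn (real_complex R) n x. Qed.
Lemma toC_sum (I : Type) (r : seq I) (P : pred I) (F : I -> R) :
  toC (\sum_(i <- r | P i) F i) = \sum_(i <- r | P i) toC (F i).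
Proof. exact: rmorph_sum (real_complex R) _ _ _ _. Qed.
Lemma toC_prod (I : Type) (r : seq I) (P : pred I) (F : I -> R) :
  toC (\prod_(i <- r | P i) F i) = \prod_(i <- r | P i) toC (F i).
Proof. exact: rmorph_prod (real_complex R) _ _ _ _. Qed.
Lemma toC_inj : injective (@toC R). Proof. by move=> x y []. Qed.

Lemma toC_conj (x : R) : (toC x)^* = toC x.
Proof.
rewrite conj_Creal //; apply/complex_realP; by exists x.
Qed.

Lemma ge0_toC (z : CC R) : 0 <= z -> z = toC (complex.Re z).
Proof. by move=> z0; rewrite /toC RRe_real // ger0_real. Qed.

Definition rnorm V (x : V) : R := complex.Re `|x|.

Lemma rnormE V (x : V) : `|x| = toC (rnorm x).
Proof. exact: ge0_toC. Qed.

Lemma rnorm_ge0 V (x : V) : 0 <= rnorm x.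
Proof. by rewrite -toC_le -rnormE toC0. Qed.

Lemma rnormD V (x y : V) : rnorm (x + y) <= rnorm x + rnorm y.
Proof. by rewrite -toC_le toCD -!rnormE ler_normD. Qed.

Lemma rnormN V (x : V) : rnorm (- x) = rnorm x.
Proof. by rewrite /rnorm normrN. Qed.

Lemma rnormB V (x y : V) : rnorm (x - y) = rnorm (y - x).
Proof. by rewrite /rnorm distrC. Qed.

Lemma rnorm0 V : rnorm (0 : V) = 0.
Proof. by rewrite /rnorm normr0. Qed.

Lemma rnormZ V (c : CC R) (x : V) : rnorm (c *: x) = rnorm c * rnorm x.
Proof. by apply: toC_inj; rewrite toCM -!rnormE normrZ. Qed.

Lemma rnormM (c d : CC R) : rnorm (c * d) = rnorm c * rnorm d.
Proof. exact: rnormZ. Qed.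

Lemma rnorm_eq0 V (x : V) : rnorm x <= 0 -> x = 0.
Proof.
move=> x0; apply: normr0_eq0; rewrite rnormE -toC0; congr toC.
by apply/eqP; rewrite eq_le x0 rnorm_ge0.
Qed.

Lemma rnorm_toC (x : R) : 0 <= x -> rnorm (toC x) = x.
Proof. by move=> x0; rewrite /rnorm ger0_norm // -toC0 toC_le. Qed.

Lemma rnorm1 : rnorm (1 : CC R) = 1.
Proof. by rewrite -toC1 rnorm_toC. Qed.

Lemma rnorm_conj (z : CC R) : rnorm z^* = rnorm z.
Proof. by rewrite /rnorm norm_conjC. Qed.

Lemma rnormX (c : CC R) n : rnorm (c ^+ n) = rnorm c ^+ n.
Proof. by apply: toC_inj; rewrite toCX -!rnormE normrX. Qed.

Lemma rnorm_sum V (I : Type) (r : seq I) (P : pred I) (F : I -> V) :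
  rnorm (\sum_(i <- r | P i) F i) <= \sum_(i <- r | P i) rnorm (F i).
Proof.
rewrite -toC_le toC_sum -rnormE (le_trans (ler_norm_sum _ _ _)) //.
by rewrite le_eqVlt; apply/orP; left; apply/eqP/eq_bigr => i _; rewrite rnormE.
Qed.

Lemma conj_norm2 (z : CC R) : z * z^* = toC (rnorm z ^+ 2).
Proof. by rewrite -normCK rnormE toCX. Qed.

Lemma complex_eta (z : CC R) : z = toC (complex.Re z) + 'i%C * toC (complex.Im z).
Proof. exact: complexE. Qed.

Lemma rnorm_i : rnorm ('i%C : CC R) = 1.
Proof.
by rewrite /rnorm normc_def /= expr0n /= expr1n add0r sqrtr1.
Qed.

Lemma normRe_le (z : CC R) : `|complex.Re z| <= rnorm z.
Proof. by rewrite -toC_le -rnormE; exact: normc_ge_Re. Qed.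

Lemma normIm_le (z : CC R) : `|complex.Im z| <= rnorm z.
Proof.
case: z => a b; rewrite /rnorm normc_def /= -[leLHS]sqrtr_sqr.
by rewrite ler_wsqrtr // lerDr sqr_ge0.
Qed.

Lemma normr_toC (x : R) : `|toC x| = toC `|x|.
Proof. by rewrite normc_def /= expr0n addr0 sqrtr_sqr. Qed.

Lemma rnorm_toCE (x : R) : rnorm (toC x) = `|x|.
Proof. by rewrite /rnorm normr_toC. Qed.

Definition seq_cvg V (u : nat -> V) (l : V) : Prop :=
  forall e : R, 0 < e -> exists N : nat, forall n, (N <= n)%N -> rnorm (u n - l) < e.

Definition seq_cauchy V (u : nat -> V) : Prop :=
  forall e : R, 0 < e ->
    exists N : nat, forall n k, (N <= n)%N -> (N <= k)%N -> rnorm (u n - u k) < e.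

Definition seq_complete V : Prop :=
  forall u : nat -> V, seq_cauchy u -> exists l, seq_cvg u l.

Lemma pos_toC (e : CC R) : 0 < e -> exists2 r : R, 0 < r & e = toC r.
Proof.
move=> e0; have eE := ge0_toC (ltW e0); exists (complex.Re e) => //.
by rewrite -toC_lt -eE toC0.
Qed.

Lemma nbhs_rnorm V (x : V) (A : set V) :
  nbhs x A <-> exists2 e : R, 0 < e & forall y, rnorm (y - x) < e -> A y.
Proof.
rewrite -nbhs_ballE; split.
  case=> e /= /pos_toC[r r0 ->] eA; exists r => // y yx.
  by apply: eA; rewrite -ball_normE /= rnormE toC_lt rnormB.
case=> e e0 eA; exists (toC e); first by rewrite /= -toC0 toC_lt.
by move=> y; rewrite -ball_normE /= rnormE toC_lt rnormB; exact: eA.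
Qed.

Lemma seq_cvgP V (u : nat -> V) (l : V) : u @ \oo --> l <-> seq_cvg u l.
Proof.
split=> [ul e e0|ul A /nbhs_rnorm[e e0 eA]].
  have /ul[N _ NP] : nbhs l [set y | rnorm (y - l) < e].
    by apply/nbhs_rnorm; exists e.
  by exists N => n Nn; exact: NP.
by have [N NP] := ul e e0; exists N => // n /= Nn; apply: eA; exact: NP.
Qed.

Lemma inv_succ_lt (e : R) : 0 < e ->
  exists N : nat, forall n, (N <= n)%N -> n.+1%:R^-1 < e.
Proof.
move=> e0; exists (Num.truncn e^-1) => n Nn; rewrite invf_plt ?posrE ?ltr0n //.
by rewrite (lt_le_trans (truncnS_gt _)) // ler_nat ltnS.
Qed.

(** Members of a proper filter meet, so centres of balls of radius [n.+1%:R^-1] belonging to [F]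
    form a Cauchy sequence, and its limit is a limit of [F]. This turns sequential completeness into
    the completeness of the uniform structure. *)
Lemma seq_complete_cvg V : seq_complete V ->
  forall F : set_system V, ProperFilter F -> cauchy F -> cvg F.
Proof.
move=> Vc F FF /cauchyP Fc.
have xP n : exists x : V, F [set y | rnorm (y - x) < n.+1%:R^-1].
  have [|x Fx] := Fc (toC n.+1%:R^-1).
    by rewrite -toC0 toC_lt invr_gt0 ltr0n.
  exists x; move: Fx; apply: filterS => y.
  by rewrite -ball_normE /= rnormE toC_lt rnormB.
have [x {}xP] := choice xP.
have [l xl] : exists l, seq_cvg x l.
  apply: Vc => e e0; have [|N NP] := inv_succ_lt (e := e / 2); first by rewrite divr_gt0.
  exists N => n k Nn Nk.
  have [y [yn yk]] := filter_ex (filterI (xP n) (xP k)).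
  have -> : x n - x k = (x n - y) + (y - x k) by rewrite addrA subrK.
  rewrite (le_lt_trans (rnormD _ _)) // rnormB [e]splitr ltrD //.
    exact: (lt_trans yn (NP _ Nn)).
  exact: (lt_trans yk (NP _ Nk)).
apply/cvg_ex; exists l => A /nbhs_rnorm[e e0 eA].
have [|N1 N1P] := inv_succ_lt (e := e / 2); first by rewrite divr_gt0.
have [|N2 N2P] := xl (e / 2); first by rewrite divr_gt0.
set n := maxn N1 N2; apply: filterS (xP n) => y /= yn; apply: eA.
have -> : y - l = (y - x n) + (x n - l) by rewrite addrA subrK.
rewrite (le_lt_trans (rnormD _ _)) // [e]splitr ltrD //.
  by rewrite (lt_trans yn) // N1P // leq_maxl.
by rewrite N2P // leq_maxr.
Qed.

Lemma complete_seq_complete (V : completeNormedModType (CC R)) : seq_complete V.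
Proof.
move=> u uc.
have : cauchy (u @ \oo).
  apply: cauchy_exP => e /pos_toC[r r0 ->]; have [N NP] := uc r r0.
  exists (u N); exists N => // n /= Nn.
  by rewrite -ball_normE /= rnormE toC_lt NP.
by move/cauchy_cvg/cvg_ex => [l /seq_cvgP ul]; exists l.
Qed.

Lemma real_seq_complete (u : nat -> R) :
  (forall e, 0 < e -> exists N : nat, forall n k, (N <= n)%N -> (N <= k)%N ->
     `|u n - u k| < e) ->
  exists l, forall e, 0 < e -> exists N : nat, forall n, (N <= n)%N -> `|u n - l| < e.
Proof.
move=> uc; have : cauchy (u @ \oo).
  apply: cauchy_exP => e e0; have [N NP] := uc e e0.
  exists (u N); exists N => // n /= Nn.
  by rewrite -ball_normE /= NP.
move/cauchy_cvg/cvg_ex => [l /= /cvgrPdist_lt ul]; exists l => e e0.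
have [N _ NP] := ul e e0; exists N => n Nn; by rewrite distrC; exact: NP.
Qed.

Lemma CC_seq_complete : seq_complete (CC R).
Proof.
move=> u uc.
have [|a ua] := @real_seq_complete (fun n => complex.Re (u n)).
  move=> e /uc[N NP]; exists N => n k Nn Nk.
  have := normRe_le (u n - u k); rewrite raddfB => /le_lt_trans; apply; exact: NP.
have [|b ub] := @real_seq_complete (fun n => complex.Im (u n)).
  move=> e /uc[N NP]; exists N => n k Nn Nk.
  have := normIm_le (u n - u k); rewrite raddfB => /le_lt_trans; apply; exact: NP.
exists (toC a + 'i%C * toC b) => e e0.
have [|N1 N1P] := ua (e / 2); first by rewrite divr_gt0.
have [|N2 N2P] := ub (e / 2); first by rewrite divr_gt0.
exists (maxn N1 N2) => n; rewrite geq_max => /andP[n1 n2].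
rewrite [u n]complex_eta opprD addrACA -toCN -toCD -mulrBr -toCN -toCD.
rewrite (le_lt_trans (rnormD _ _)) // rnormM rnorm_i mul1r !rnorm_toCE.
by rewrite [e]splitr ltrD ?N1P ?N2P.
Qed.

End RealNorm.

(** * Operations on sequential limits, and bounded monotone sequences *)

Section SeqLimits.
Variable R : realType.
Implicit Types (V : normedModType (CC R)).

Lemma seq_cvg_unique V (u : nat -> V) a b : seq_cvg u a -> seq_cvg u b -> a = b.
Proof.
move=> ua ub; apply/eqP; rewrite -subr_eq0; apply/eqP/rnorm_eq0.
rewrite leNgt; apply/negP => ab0.
have [|N1 N1P] := ua (rnorm (a - b) / 2); first by rewrite divr_gt0.
have [|N2 N2P] := ub (rnorm (a - b) / 2); first by rewrite divr_gt0.
have := rnormD (a - u (maxn N1 N2)) (u (maxn N1 N2) - b); rewrite addrA subrK.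
rewrite leNgt => /negP; apply; rewrite [ltRHS]splitr ltrD //.
  by rewrite rnormB N1P // leq_maxl.
by rewrite N2P // leq_maxr.
Qed.

Lemma seq_cvg_lin V (c : CC R) (u v : nat -> V) a b :
  seq_cvg u a -> seq_cvg v b -> seq_cvg (fun n => c *: u n + v n) (c *: a + b).
Proof.
move=> /seq_cvgP ua /seq_cvgP vb; apply/seq_cvgP.
by apply: cvgD vb; apply: cvgZ ua; exact: cvg_cst.
Qed.

Lemma seq_cvg_eventually V (u : nat -> V) a N :
  (forall n, (N <= n)%N -> u n = a) -> seq_cvg u a.
Proof. by move=> ua e e0; exists N => n Nn; rewrite ua // subrr rnorm0. Qed.

Lemma seq_cvg_conj (u : nat -> CC R) a :
  seq_cvg u a -> seq_cvg (fun n => (u n)^*) a^*.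
Proof.
move=> ua e /ua[N NP]; exists N => n Nn.
by rewrite -rmorphB rnorm_conj NP.
Qed.

Lemma seq_cvg_rnorm V (u : nat -> V) a :
  seq_cvg u a -> (fun n => rnorm (u n)) @ \oo --> rnorm a.
Proof.
move=> ua; apply/cvgrPdist_lt => e e0; have [N NP] := ua e e0.
exists N => // n /= Nn; apply: le_lt_trans (NP n Nn).
rewrite distrC ler_norml.
have h1 := rnormD (u n - a) a; rewrite subrK in h1.
have h2 := rnormD (a - u n) (u n); rewrite subrK rnormB in h2.
by apply/andP; split; lra.
Qed.

(** Beyond an index where [u] is within [e] of its supremum, all values lie between that one and the
    supremum. *)
Lemma monotone_cauchy (u : nat -> R) (M : R) :
  {homo u : n k / (n <= k)%N >-> n <= k} -> (forall n, u n <= M) ->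
  forall e, 0 < e -> exists N : nat, forall n k, (N <= n)%N -> (n <= k)%N ->
    u k - u n < e.
Proof.
move=> un uM e e0.
have uS : has_sup (range u).
  by split; [exists (u 0%N); exists 0%N | exists M => _ [n _ <-]].
have [_ [N _ <-] NP] := sup_adherent e0 uS.
exists N => n k Nn _; have := un _ _ Nn.
have : u k <= sup (range u) by apply: sup_upper_bound => //; exists k.
lra.
Qed.

End SeqLimits.

(** * Cauchy-Schwarz and triangle inequality for a positive definite form *)

Section DotGeneral.
Variables (R : realType) (U : lmodType (CC R)) (form : {dot U for Num.conj}).

Lemma dot_CauchySchwarz (u v : U) : `|form u v| ^+ 2 <= form u u * form v v.
Proof.
have [->|v0] := eqVneq v 0.
  have f0 w : form w 0 = 0 by exact: linear0r.
  by rewrite !f0 normr0 expr0n /= mulr0.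
have vv : 0 < form v v by rewrite dnorm_gt0.
(* The coefficient of the orthogonal projection of [u] on [v]; the inequality is the nonnegativity
   of the squared norm of [u - a *: v]. *)
pose a := form u v / form v v.
have := dnorm_ge0 form (u - a *: v).
rewrite dnormB dnormZ linearZr_LR /= -/(form u v).
set d := form u v in a *; set y := form v v in vv a *.
have yC : y^* = y by rewrite conj_Creal // ger0_real // ltW.
have -> : `|a| ^+ 2 * y = `|d| ^+ 2 / y.
  rewrite normf_div [`|y|]ger0_norm ?(ltW vv) // expr_div_n -mulrA.
  by congr (_ * _); rewrite expr2 invfM -mulrA mulVf ?mulr1 ?gt_eqF.
have -> : a^* * d = `|d| ^+ 2 / y.
  by rewrite normCK rmorphM fmorphV /= yC mulrAC [d * _]mulrC.
rewrite [(_ / y)^*]rmorphM fmorphV /= yC.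
rewrite [(`|d| ^+ 2)^*]conj_Creal ?ger0_real ?exprn_ge0 //.
by rewrite opprD addrA addrK subr_ge0 ler_pdivrMr.
Qed.

Lemma dot_triangle (u v : U) :
  sqrtC (form (u + v) (u + v)) <= sqrtC (form u u) + sqrtC (form v v).
Proof.
have nn x : 0 <= sqrtC (form x x) by rewrite sqrtC_ge0 dnorm_ge0.
rewrite -(@ler_pXn2r _ 2) ?nnegrE ?addr_ge0 // sqrrD !sqrtCK dnormD.
rewrite [leRHS]addrAC lerD2l.
have CS : `|form u v| <= sqrtC (form u u) * sqrtC (form v v).
  rewrite -(@ler_pXn2r _ 2) ?nnegrE ?mulr_ge0 // exprMn !sqrtCK.
  exact: dot_CauchySchwarz.
have -> : form u v + (form u v)^* = 'Re (form u v) *+ 2.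
  by rewrite ReE -mulr_natr divfK // pnatr_eq0.
rewrite lerMn2r /=; apply: le_trans CS.
exact: (leif_Re_Creal _).1.
Qed.

End DotGeneral.

(** * The space of square-summable families *)

Section SquareSummable.
Variables (R : realType) (I : countType).
Implicit Types f g : I -> CC R.

(** The elements with code below [n]; codes of no element are skipped. Sums over [I] become limits
    along an increasing, exhausting chain of finite lists. *)
Definition trunc (n : nat) : seq I := pmap (@pickle_inv I) (iota 0 n).

Lemma trunc_uniq n : uniq (trunc n).
Proof. by apply: pmap_uniq (iota_uniq 0 n); exact: pickle_invK. Qed.

Lemma mem_trunc n i : (i \in trunc n) = (pickle i < n)%N.
Proof.
apply/idP/idP => [|ni].
  rewrite mem_pmap => /mapP[k]; rewrite mem_iota add0n => /= kn ki.
  by have := @pickle_invK I k; rewrite -ki /= => ->.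
rewrite mem_pmap; apply/mapP; exists (pickle i); first by rewrite mem_iota.
by rewrite pickleK_inv.
Qed.

Lemma trunc_sum_le n k (G : I -> R) : (forall i, 0 <= G i) -> (n <= k)%N ->
  \sum_(i <- trunc n) G i <= \sum_(i <- trunc k) G i.
Proof.
move=> G0 nk; rewrite /trunc -(subnKC nk) iotaD pmap_cat big_cat /=.
by rewrite lerDl sumr_ge0.
Qed.

Definition sqsum n f : R := \sum_(i <- trunc n) rnorm (f i) ^+ 2.

Lemma sqsum_ge0 n f : 0 <= sqsum n f.
Proof. by apply: sumr_ge0 => i _; rewrite sqr_ge0. Qed.

Lemma sqsum_homo f : {homo sqsum^~ f : n k / (n <= k)%N >-> n <= k}.
Proof. by move=> n k; apply: trunc_sum_le => i; rewrite sqr_ge0. Qed.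

Definition ell2_pred : {pred I -> CC R} :=
  fun f => `[< exists M : R, forall n, sqsum n f <= M >].

Lemma ell2_predP f : reflect (exists M : R, forall n, sqsum n f <= M) (f \in ell2_pred).
Proof. exact: asboolP. Qed.

Lemma ell2_submod_closed : submod_closed ell2_pred.
Proof.
split=> [|c f g /ell2_predP[M fM] /ell2_predP[N gN]]; apply/ell2_predP.
  by exists 0 => n; rewrite /sqsum big1 // => i _; rewrite rnorm0 expr0n.
(* The factor 2 comes from [(y + z) ^+ 2 <= 2 * (y ^+ 2 + z ^+ 2)], applied to each coordinate. *)
exists (2 * (rnorm c ^+ 2 * M + N)) => n.
apply: (@le_trans _ _ (2 * (rnorm c ^+ 2 * sqsum n f + sqsum n g))).
  rewrite /sqsum mulr_sumr -big_split mulr_sumr; apply: ler_sum => i _ /=.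
  rewrite -exprMn -rnormM; have := rnormD (c * f i) (g i).
  rewrite -[(c *: f + g) i]/(c * f i + g i).
  move: (rnorm_ge0 (c * f i + g i)) (rnorm_ge0 (c * f i)) (rnorm_ge0 (g i)).
  move: (rnorm (c * f i + g i)) (rnorm (c * f i)) (rnorm (g i)) => x y z.
  by move=> x0 y0 z0 xyz; have := sqr_ge0 (y - z); nra.
by rewrite ler_pM2l // lerD // ler_wpM2l // sqr_ge0.
Qed.

Record ell2 := Ell2 { ell2_fun :> I -> CC R; ell2_bounded : ell2_fun \in ell2_pred }.
HB.instance Definition _ := [isSub for ell2_fun].
HB.instance Definition _ := [Choice of ell2 by <:].
HB.instance Definition _ := GRing.isSubmodClosed.Build _ _ ell2_pred ell2_submod_closed.
HB.instance Definition _ := [SubChoice_isSubLmodule of ell2 by <:].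

Lemma ell2P (x : ell2) : exists M : R, forall n, sqsum n x <= M.
Proof. exact/ell2_predP/ell2_bounded. Qed.

Lemma ell2_linE (c : CC R) (x y : ell2) i : (c *: x + y) i = c * x i + y i.
Proof. by []. Qed.

Lemma ell2BE (x y : ell2) i : (x - y) i = x i - y i.
Proof. by []. Qed.

Definition psum n f g : CC R := \sum_(i <- trunc n) f i * (g i)^*.

(** Termwise [y * z <= y ^+ 2 + z ^+ 2]. The Cauchy property of the partial inner products is
    thereby reduced to that of two bounded increasing real sequences. *)
Lemma psum_diff f g n k : (n <= k)%N -> 
  rnorm (psum k f g - psum n f g) <= (sqsum k f - sqsum n f) + (sqsum k g - sqsum n g).
Proof.
move=> nk; rewrite /psum /sqsum /trunc -(subnKC nk) iotaD pmap_cat !big_cat /=.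
have addK (Z : zmodType) (a b : Z) : a + b - a = b by rewrite addrAC subrr add0r.
rewrite !addK -big_split.
apply: le_trans (rnorm_sum _ _ _) _; apply: ler_sum => i _ /=.
rewrite rnormM rnorm_conj.
move: (rnorm_ge0 (f i)) (rnorm_ge0 (g i)); move: (rnorm (f i)) (rnorm (g i)) => y z.
by move=> y0 z0; have := sqr_ge0 (y - z); nra.
Qed.

Lemma psum_cvg (x y : ell2) : exists l, seq_cvg (fun n => psum n x y) l.
Proof.
apply: CC_seq_complete => e e0; have [M xM] := ell2P x; have [M' yM] := ell2P y.
have [|N1 N1P] := @monotone_cauchy _ (sqsum^~ x) M (@sqsum_homo x) xM (e / 2).
  by rewrite divr_gt0.
have [|N2 N2P] := @monotone_cauchy _ (sqsum^~ y) M' (@sqsum_homo y) yM (e / 2).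
  by rewrite divr_gt0.
suff H n k : (maxn N1 N2 <= n)%N -> (n <= k)%N ->
    rnorm (psum k x y - psum n x y) < e.
  exists (maxn N1 N2) => n k Nn Nk; case/orP: (leq_total n k) => nk.
    by rewrite rnormB H.
  by rewrite H.
rewrite geq_max => /andP[n1 n2] nk; apply: le_lt_trans (psum_diff _ _ nk) _.
by rewrite [e]splitr ltrD ?N1P ?N2P.
Qed.

(** The default 0 of [xget] is never reached, since the limit exists by [psum_cvg]. *)
Definition ell2_dot (x y : ell2) : CC R := xget 0 (seq_cvg (fun n => psum n x y)).

Lemma ell2_dotP (x y : ell2) : seq_cvg (fun n => psum n x y) (ell2_dot x y).
Proof. by have [l xl] := psum_cvg x y; exact: (@xgetPex _ 0 _ (ex_intro _ l xl)). Qed.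

Lemma ell2_dot_unique (x y : ell2) l :
  seq_cvg (fun n => psum n x y) l -> ell2_dot x y = l.
Proof. exact: seq_cvg_unique (ell2_dotP x y). Qed.

Lemma ell2_dotC (x y : ell2) : ell2_dot x y = (-1) ^+ false * (ell2_dot y x)^*.
Proof.
rewrite mul1r; apply: ell2_dot_unique.
rewrite (_ : (fun n => _) = fun n => (psum n y x)^*).
  exact: seq_cvg_conj (ell2_dotP y x).
apply/funext => n; rewrite /psum rmorph_sum; apply: eq_bigr => i _.
by rewrite rmorphM /= conjCK mulrC.
Qed.

Lemma ell2_dot_linl (y : ell2) c (x x' : ell2) :
  ell2_dot (c *: x + x') y = c * ell2_dot x y + ell2_dot x' y.
Proof.
apply: ell2_dot_unique.
rewrite (_ : (fun n => _) = fun n => c *: psum n x y + psum n x' y).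
  exact: seq_cvg_lin (ell2_dotP _ _) (ell2_dotP _ _).
apply/funext => n; rewrite /psum scaler_sumr -big_split; apply: eq_bigr => i _.
by rewrite ell2_linE mulrDl -mulrA.
Qed.

Lemma ell2_dot_bilinear : bilinear_for *%R (Num.conj \; *%R) ell2_dot.
Proof.
split=> [y c x x'|y c x x']; first exact: ell2_dot_linl.
rewrite ell2_dotC mul1r ell2_dot_linl rmorphD rmorphM /= [ell2_dot y x]ell2_dotC.
by rewrite [ell2_dot y x']ell2_dotC !mul1r.
Qed.

HB.instance Definition _ :=
  bilinear_isBilinear.Build (CC R) ell2 ell2 (CC R) *%R (Num.conj \; *%R) ell2_dot
    ell2_dot_bilinear.

HB.instance Definition _ :=
  isHermitianSesquilinear.Build (CC R) ell2 false Num.conj ell2_dot ell2_dotC.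

Lemma psum_self n f : psum n f f = toC (sqsum n f).
Proof. by rewrite /psum toC_sum; apply: eq_bigr => i _; rewrite conj_norm2. Qed.

(** The increasing partial sums converge to their supremum, which serves as [s]. *)
Lemma ell2_dot_real (x : ell2) :
  exists2 s : R, ell2_dot x x = toC s & forall n, sqsum n x <= s.
Proof.
have [M xM] := ell2P x; have xS : has_sup (range (sqsum^~ x)).
  by split; [exists (sqsum 0 x); exists 0%N | exists M => _ [n _ <-]].
exists (sup (range (sqsum^~ x))); last first.
  by move=> n; apply: sup_upper_bound => //; exists n.
apply: ell2_dot_unique => e e0; have [_ [N _ <-] NP] := sup_adherent e0 xS.
exists N => n Nn; rewrite psum_self -toCN -toCD rnorm_toCE.
have : sqsum n x <= sup (range (sqsum^~ x)) by apply: sup_upper_bound => //; exists n.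
have := @sqsum_homo x _ _ Nn.
by move=> h1 h2; rewrite ler0_norm; lra.
Qed.

Lemma ell2_dot_gt0 (x : ell2) : x != 0 -> 0 < ell2_dot x x.
Proof.
move=> x0; have [s -> sP] := ell2_dot_real x.
rewrite -toC0 toC_lt.
have [i xi] : exists i, x i != 0.
  apply: contrapT => xn; move/eqP: x0; apply; apply/val_inj/funext => i.
  by apply: contrapT => /eqP xi; apply: xn; exists i.
apply: lt_le_trans (sP (pickle i).+1).
rewrite /sqsum (bigD1_seq i) ?trunc_uniq ?mem_trunc //=.
rewrite ltr_wpDr ?sumr_ge0 // => [j _|]; first by rewrite sqr_ge0.
rewrite exprn_gt0 // lt_neqAle rnorm_ge0 andbT eq_sym.
by apply: contraNneq xi => xi; apply/eqP/rnorm_eq0; rewrite xi.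
Qed.

HB.instance Definition _ := isDotProduct.Build (CC R) ell2 ell2_dot ell2_dot_gt0.

Definition ell2_norm (x : ell2) : CC R := sqrtC (ell2_dot x x).

Lemma ell2_normD x y : ell2_norm (x + y) <= ell2_norm x + ell2_norm y.
Proof. exact: (dot_triangle ell2_dot). Qed.

Lemma ell2_normZ (c : CC R) x : ell2_norm (c *: x) = `|c| * ell2_norm x.
Proof.
rewrite /ell2_norm (dnormZ ell2_dot) sqrtCM ?nnegrE ?exprn_ge0 ?(dnorm_ge0 ell2_dot) //.
by rewrite sqrCK.
Qed.

Lemma ell2_norm_eq0 x : ell2_norm x = 0 -> x = 0.
Proof. by move/eqP; rewrite sqrtC_eq0 (dnorm_eq0 ell2_dot) => /eqP. Qed.

HB.instance Definition _ :=
  Lmodule_isNormed.Build (CC R) ell2 ell2_normD ell2_normZ ell2_norm_eq0.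

Lemma ell2_norm2 (x : ell2) : `|x| ^+ 2 = ell2_dot x x.
Proof. exact: sqrtCK. Qed.

Lemma sqsum_le_norm (x : ell2) n : sqsum n x <= rnorm x ^+ 2.
Proof.
have [s xs sP] := ell2_dot_real x; suff -> : rnorm x ^+ 2 = s by [].
by apply: toC_inj; rewrite toCX -rnormE ell2_norm2.
Qed.

Lemma rnorm_ell2_dot (x : ell2) : rnorm (ell2_dot x x) = rnorm x ^+ 2.
Proof. by rewrite -ell2_norm2 rnormE -toCX rnorm_toC ?sqr_ge0. Qed.

Lemma norm_le_sqsum (x : ell2) M : (forall n, sqsum n x <= M) -> rnorm x ^+ 2 <= M.
Proof.
move=> xM.
have := seq_cvg_rnorm (ell2_dotP x x); rewrite rnorm_ell2_dot => h.
rewrite -(cvg_lim (@Rhausdorff R) h); apply: limr_le.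
  by apply/cvg_ex; eexists; exact: h.
by exists 0%N => // n _; rewrite /= psum_self rnorm_toCE ger0_norm ?sqsum_ge0.
Qed.

Lemma coord_le_norm (x : ell2) i : rnorm (x i) <= rnorm x.
Proof.
rewrite -(@ler_pXn2r _ 2) ?nnegrE ?rnorm_ge0 //.
apply: le_trans (sqsum_le_norm x (pickle i).+1).
rewrite /sqsum (bigD1_seq i) ?trunc_uniq ?mem_trunc //= lerDl sumr_ge0 // => j _.
by rewrite sqr_ge0.
Qed.

Lemma sqsum_cvg n (u : nat -> I -> CC R) f :
  (forall i, seq_cvg (u^~ i) (f i)) ->
  (fun k => sqsum n (u k)) @ \oo --> sqsum n f.
Proof.
move=> uf; rewrite /sqsum; elim: (trunc n) => [|i s IH].
  rewrite big_nil (_ : (fun k => _) = fun=> 0); first exact: cvg_cst.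
  by apply/funext => k; rewrite big_nil.
rewrite big_cons (_ : (fun k => _) =
  fun k => rnorm (u k i) ^+ 2 + \sum_(j <- s) rnorm (u k j) ^+ 2); last first.
  by apply/funext => k; rewrite big_cons.
apply: cvgD IH; rewrite expr2.
by rewrite (_ : (fun k => _) = fun k => rnorm (u k i) * rnorm (u k i)) //;
  apply: cvgM; apply: seq_cvg_rnorm (uf i).
Qed.

Lemma ell2_complete : seq_complete ell2.
Proof.
move=> u uc.
have uci i : exists l, seq_cvg (fun k => u k i) l.
  apply: CC_seq_complete => e /uc[N NP]; exists N => n k Nn Nk.
  by rewrite -ell2BE (le_lt_trans (coord_le_norm _ _)) // NP.
have [g gP] := choice uci.
(* On a finite truncation the Cauchy estimate passes to the coordinatewise limit [g]. The bound is
   uniform in [n], so it yields both square summability and norm convergence. *)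
have tail e : 0 < e -> exists N : nat, forall k, (N <= k)%N ->
    forall n, sqsum n (fun i => u k i - g i) <= e ^+ 2.
  move=> /uc[N NP]; exists N => k Nk n.
  have h : (fun j => sqsum n (fun i => u k i - u j i)) @ \oo -->
      sqsum n (fun i => u k i - g i).
    apply: (@sqsum_cvg n (fun j i => u k i - u j i)) => i d /(gP i)[K KP].
    exists K => j Kj; rewrite opprB addrC addrA subrK rnormB; exact: KP.
  rewrite -(cvg_lim (@Rhausdorff R) h); apply: limr_le.
    by apply/cvg_ex; eexists; exact: h.
  exists N => // j /= Nj; apply: le_trans (sqsum_le_norm (u k - u j) n) _.
  by rewrite ler_pXn2r ?nnegrE ?rnorm_ge0 // ?ltW ?NP // (le_lt_trans (rnorm_ge0 _) (NP k j Nk Nj)).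
have [N NP] := tail 1 ltr01.
have dP : (fun i => u N i - g i) \in ell2_pred by apply/ell2_predP; exists (1 ^+ 2); exact: NP.
(* Only the difference of [u N] and [g] is known to be square summable, so the limit is built as
   [u N - d]; its coordinates are those of [g]. *)
pose d := Ell2 dP; exists (u N - d) => e e0.
have [|K KP] := tail (e / 2); first by rewrite divr_gt0.
exists K => k Kk; apply: (@le_lt_trans _ _ (e / 2)); last by lra.
rewrite -(@ler_pXn2r _ 2) ?nnegrE ?rnorm_ge0 ?divr_ge0 ?(ltW e0) //.
apply: norm_le_sqsum => n; apply: le_trans (KP k Kk n).
rewrite le_eqVlt; apply/orP; left; apply/eqP; apply: eq_bigr => i _.
rewrite -[(u k - (u N - d)) i]/(u k i - (u N i - (u N i - g i))).
by rewrite subKr.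
Qed.

HB.instance Definition _ :=
  Uniform_isComplete.Build ell2 (seq_complete_cvg ell2_complete).

Lemma ell2_dot_finite (x y : ell2) (s : seq I) : uniq s ->
  (forall i, i \notin s -> x i = 0) ->
  ell2_dot x y = \sum_(i <- s) x i * (y i)^*.
Proof.
move=> us xs; apply: ell2_dot_unique.
apply: (@seq_cvg_eventually _ _ _ _ (\max_(i <- s) (pickle i).+1)) => n Nn.
have sn i : i \in s -> i \in trunc n.
  by move=> si; rewrite mem_trunc (leq_trans _ Nn) // (@leq_bigmax_seq _ s xpredT (fun i => (pickle i).+1) i).
rewrite /psum (bigID (mem s)) /= [X in _ + X]big1 ?addr0 => [|i /xs ->]; last by rewrite mul0r.
rewrite -big_filter; apply: perm_big; apply: uniq_perm => //.
  by rewrite filter_uniq ?trunc_uniq.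
move=> i; rewrite mem_filter /=; case: (boolP (i \in s)) => //= /sn ->//.
Qed.

End SquareSummable.

(** * Coefficients and norm bounds on polynomials *)

Section SumComparison.
Variables (R : realType) (I : eqType).

Lemma sum_le_supp (s t : seq I) (G : I -> R) : uniq s -> uniq t ->
  (forall i, 0 <= G i) -> (forall i, i \in s -> i \notin t -> G i = 0) ->
  \sum_(i <- s) G i <= \sum_(i <- t) G i.
Proof.
move=> us ut G0 Gst.
rewrite (bigID (mem t)) /= [X in _ + X]big_seq_cond [X in _ + X]big1 ?addr0; last first.
  by move=> i /andP[]; exact: Gst.
rewrite [leRHS](bigID (mem s)) /= -big_filter -[in leRHS]big_filter.
have -> : \sum_(i <- [seq i <- s | i \in t]) G i = \sum_(i <- [seq i <- t | i \in s]) G i.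
  apply: perm_big; apply: uniq_perm; rewrite ?filter_uniq // => i.
  by rewrite !mem_filter andbC.
by rewrite lerDl sumr_ge0.
Qed.

Lemma sum_eq_supp (Z : nmodType) (s t : seq I) (G : I -> Z) : uniq s -> uniq t ->
  (forall i, i \in s -> i \notin t -> G i = 0) ->
  (forall i, i \in t -> i \notin s -> G i = 0) ->
  \sum_(i <- s) G i = \sum_(i <- t) G i.
Proof.
move=> us ut Gst Gts.
rewrite (bigID (mem t)) /= [X in _ + X]big_seq_cond [X in _ + X]big1 ?addr0; last first.
  by move=> i /andP[]; exact: Gst.
rewrite [RHS](bigID (mem s)) /= [X in _ = _ + X]big_seq_cond [X in _ = _ + X]big1 ?addr0; last first.
  by move=> i /andP[]; exact: Gts.
rewrite -big_filter -[in RHS]big_filter.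
apply: perm_big; apply: uniq_perm; rewrite ?filter_uniq // => i.
by rewrite !mem_filter andbC.
Qed.

Lemma sum_delta (Z : pzRingType) (s : seq I) (c : I -> Z) j : uniq s ->
  \sum_(i <- s) c i * (i == j)%:R = if j \in s then c j else 0.
Proof.
move=> us; case: ifPn => [js|js].
  rewrite (bigD1_seq j) //= eqxx mulr1 big1 ?addr0 // => i /negPf ij.
  by rewrite ij mulr0.
rewrite big_seq big1 // => i si; case: eqP => [ij|]; rewrite ?mulr0 //.
by move: js; rewrite -ij si.
Qed.

End SumComparison.

Section Support.
Variables (R : realType) (m : nat).
Implicit Types (f g : fpoly R m).

Definition bidx : countType := ({set 'I_m} * multinom (m + m))%type.
Implicit Types (i j : bidx).

Definition bcoef f i : CC R := mcoeff i.2 (f i.1).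

Definition bsupp f : seq bidx :=
  [seq ((T, a) : bidx) | T <- enum {: {set 'I_m}}, a <- msupp (f T)].

Lemma bsupp_uniq f : uniq (bsupp f).
Proof.
apply: allpairs_uniq_dep; first exact: enum_uniq.
  by move=> S _; exact: msupp_uniq.
by move=> [S a] [S' a'] _ _ /= [-> ->].
Qed.

Lemma mem_bsupp f i : (i \in bsupp f) = (bcoef f i != 0).
Proof.
case: i => S a; rewrite /bcoef -mcoeff_msupp /=; apply/allpairsPdep/idP => [|aS].
  by move=> [S' [a' [_ a'S [-> ->]]]].
by exists S, a; rewrite mem_enum.
Qed.

Lemma bcoef_lin c f g i : bcoef (c *: f + g) i = c * bcoef f i + bcoef g i.
Proof. by rewrite /bcoef !ffunE mcoeffD mcoeffZ. Qed.

Lemma bcoef0 i : bcoef 0 i = 0.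
Proof. by rewrite /bcoef ffunE mcoeff0. Qed.

Lemma bcoefP f g : (forall i, bcoef f i = bcoef g i) -> f = g.
Proof. by move=> fg; apply/ffunP => S; apply/mpolyP => a; exact: (fg (S, a)). Qed.

Definition bmono i : fpoly R m := [ffun S => if S == i.1 then mpolyX (CC R) i.2 else 0].

Lemma bcoef_bmono i j : bcoef (bmono i) j = (i == j)%:R.
Proof.
case: i j => [S a] [S' a']; rewrite /bcoef ffunE /= xpair_eqE eq_sym.
by case: eqP => _ /=; rewrite ?mcoeff0 ?mcoeffX.
Qed.

Lemma bcoef_sum (s : seq bidx) (c : bidx -> CC R) j : uniq s ->
  bcoef (\sum_(i <- s) c i *: bmono i) j = if j \in s then c j else 0.
Proof.
move=> us; have h : {morph bcoef^~ j : f g / f + g >-> f + g}.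
  by move=> f g; have := bcoef_lin 1 f g j; rewrite scale1r mul1r.
rewrite (big_morph (bcoef^~ j) h (bcoef0 j)).
have E i : bcoef (c i *: bmono i) j = c i * (i == j)%:R.
  by have := bcoef_lin (c i) (bmono i) 0 j; rewrite addr0 bcoef0 addr0 bcoef_bmono.
by rewrite (eq_bigr _ (fun i _ => E i)) sum_delta.
Qed.

Lemma fpoly_bmono f : f = \sum_(i <- bsupp f) bcoef f i *: bmono i.
Proof.
apply: bcoefP => j; rewrite bcoef_sum ?bsupp_uniq // mem_bsupp.
by case: eqP.
Qed.

End Support.

Lemma mnm_neq0 (n : nat) (a : multinom n) : a != @mnm0 n -> exists k, a k != 0%N.
Proof.
move=> a0; apply: contrapT => h; move/eqP: a0; apply; apply/mnmP => k.
by rewrite mnm0E; apply: contrapT => /eqP ak; apply: h; exists k.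
Qed.

Lemma mnm_subK (n : nat) (a : multinom n) k : a k != 0%N ->
  mnm_add (mnm_sub a (mnm1 k)) (mnm1 k) = a.
Proof.
move=> ak; apply/mnmP => l; rewrite mnmDE mnmBE mnm1E.
by case: eqP => [<-|_]; [rewrite subnK ?lt0n | rewrite subn0 addn0].
Qed.

(** * Jackson-Fischer weights and bounds for the elementary operators *)

Section Weights.
Variables (R : realType) (m : nat) (q : R).
Hypotheses (q0 : 0 < q) (q1 : q < 1).
Implicit Types (f g : fpoly R m) (i j : bidx m).

Lemma qnat0 : qnat q 0 = 0.
Proof. by rewrite /qnat expr0 subrr mul0r. Qed.

Lemma qnat_le n : qnat q n <= (1 - q)^-1.
Proof.
rewrite /qnat ler_pdivrMr ?subr_gt0 // mulVf ?gt_eqF ?subr_gt0 //.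
by rewrite gerBl exprn_ge0 // ltW.
Qed.

Lemma qnat_ge1 n : 1 <= qnat q n.+1.
Proof.
rewrite /qnat ler_pdivlMr ?subr_gt0 // mul1r lerD2l lerN2 exprS.
by rewrite ger_pMr // exprn_ile1 // ltW.
Qed.

Lemma qnat_ge0 n : 0 <= qnat q n.
Proof. by case: n => [|n]; rewrite ?qnat0 // (le_trans ler01) ?qnat_ge1. Qed.

Lemma qfact0 : qfact q 0 = 1.
Proof. by rewrite /qfact big_geq. Qed.

Lemma qfactS n : qfact q n.+1 = qfact q n * qnat q n.+1.
Proof. by rewrite /qfact big_nat_recr. Qed.

Lemma qfact_gt0 n : 0 < qfact q n.
Proof.
elim: n => [|n IH]; first by rewrite qfact0.
by rewrite qfactS mulr_gt0 // (lt_le_trans ltr01) ?qnat_ge1.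
Qed.

Lemma jf_weightE (a : multinom (m + m)) : jf_weight q a = \prod_k qfact q (a k).
Proof. by rewrite /jf_weight big_split_ord. Qed.

Lemma jf_weight_gt0 (a : multinom (m + m)) : 0 < jf_weight q a.
Proof. by rewrite jf_weightE; apply: prodr_gt0 => k _; exact: qfact_gt0. Qed.

Lemma jf_weightD (a : multinom (m + m)) k :
  jf_weight q (mnm_add a (mnm1 k)) = qnat q (a k).+1 * jf_weight q a.
Proof.
rewrite !jf_weightE (bigD1 k) //= [in RHS](bigD1 k) //=.
rewrite mnmDE mnm1E eqxx addn1 qfactS; move: (qnat _ _) => n.
rewrite [RHS]mulrCA mulrA; congr (_ * _).
by apply: eq_bigr => l lk; rewrite mnmDE mnm1E eq_sym (negPf lk) addn0.
Qed.

Lemma jf_dotE (s : seq (bidx m)) f g : uniq s ->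
  (forall i, i \notin s -> bcoef f i = 0) ->
  jf_dot q f g = \sum_(i <- s) bcoef f i * (bcoef g i)^* * toC (jf_weight q i.2).
Proof.
move=> us sf.
rewrite (@sum_eq_supp _ _ s (bsupp f)) ?bsupp_uniq //; first last.
- by move=> i _ /sf ->; rewrite !mul0r.
- by move=> i _; rewrite mem_bsupp negbK => /eqP ->; rewrite !mul0r.
by rewrite /jf_dot /bsupp big_allpairs_dep big_enum.
Qed.

Definition jf_norm2 f : R :=
  \sum_(i <- bsupp f) rnorm (bcoef f i) ^+ 2 * jf_weight q i.2.

Lemma jf_dot_norm2 f : jf_dot q f f = toC (jf_norm2 f).
Proof.
rewrite (@jf_dotE (bsupp f)) ?bsupp_uniq //; last first.
  by move=> i; rewrite mem_bsupp negbK => /eqP.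
by rewrite toC_sum; apply: eq_bigr => i _; rewrite conj_norm2 toCM.
Qed.

Lemma jf_dot_bmono f i : jf_dot q f (bmono R i) = bcoef f i * toC (jf_weight q i.2).
Proof.
rewrite (@jf_dotE (undup (i :: bsupp f))) ?undup_uniq //; last first.
  by move=> j; rewrite mem_undup inE negb_or mem_bsupp negbK => /andP[_ /eqP].
rewrite (bigD1_seq i) ?undup_uniq ?mem_undup ?mem_head //= bcoef_bmono eqxx.
rewrite conjC1 mulr1 big1 ?addr0 // => j ji.
by rewrite bcoef_bmono eq_sym (negPf ji) conjC0 mulr0 mul0r.
Qed.

(* In the monomial basis every operator below is a weighted shift: the
   coefficient of [T f] at [i] is a multiple of the one of [f] at [sg i]. *)
Lemma jf_norm2_shift f g (C : R) (sg : bidx m -> bidx m) : 0 <= C ->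
  {in bsupp g &, injective sg} ->
  (forall i, i \in bsupp g -> rnorm (bcoef g i) ^+ 2 * jf_weight q i.2 <=
     C * (rnorm (bcoef f (sg i)) ^+ 2 * jf_weight q (sg i).2)) ->
  jf_norm2 g <= C * jf_norm2 f.
Proof.
move=> C0 sgI gf; pose G i := rnorm (bcoef f i) ^+ 2 * jf_weight q i.2.
apply: (@le_trans _ _ (C * \sum_(i <- map sg (bsupp g)) G i)).
  by rewrite /jf_norm2 big_map mulr_sumr [leLHS]big_seq [leRHS]big_seq; apply: ler_sum => i; exact: gf.
rewrite ler_wpM2l //; apply: sum_le_supp.
- by rewrite map_inj_in_uniq ?bsupp_uniq.
- exact: bsupp_uniq.
- by move=> i; rewrite mulr_ge0 ?sqr_ge0 // ltW // jf_weight_gt0.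
- by move=> i _; rewrite mem_bsupp negbK /G => /eqP ->; rewrite rnorm0 expr0n mul0r.
Qed.

(** The q-derivative multiplies a coefficient by a q-number [n], hence its square by [n ^+ 2]. One
    factor [n] is the ratio of the weights of the two monomials, and the other is at most
    [(1 - q)^-1]. *)
Lemma jf_norm2_qderiv f k :
  jf_norm2 (coefw (qderiv q k) f) <= (1 - q)^-1 * jf_norm2 f.
Proof.
apply: (@jf_norm2_shift _ _ _ (fun i => (i.1, mnm_add i.2 (mnm1 k)) : bidx m)).
- by rewrite invr_ge0 subr_ge0 ltW.
- move=> [S a] [S' a'] _ _ /pair_equal_spec[SS aa].
  have {}SS : S = S' := SS; have {}aa : mnm_add a (mnm1 k) = mnm_add a' (mnm1 k) := aa.
  rewrite SS; congr (_, _); apply/mnmP => l.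
  by move/mnmP: aa => /(_ l); rewrite !mnmDE => /addIn.
move=> [S a] _; rewrite /bcoef ffunE /= mcoeff_qderiv // jf_weightD rnormM.
rewrite rnorm_toC ?qnat_ge0 // exprMn.
have := qnat_ge0 (a k).+1; have := qnat_le (a k).+1.
set n := qnat _ _; set r := rnorm _ ; set w := jf_weight _ _ => nle n0.
have -> : n ^+ 2 * r ^+ 2 * w = n * (r ^+ 2 * (n * w)) by ring.
have w0 : 0 < w by exact: jf_weight_gt0.
apply: ler_wpM2r => //; apply: mulr_ge0; first exact: sqr_ge0.
by apply: mulr_ge0 => //; exact: ltW.
Qed.

Lemma jf_norm2_mulX f k :
  jf_norm2 (coefw ( *%R (mpolyX (CC R) (mnm1 k))) f) <= (1 - q)^-1 * jf_norm2 f.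
Proof.
(* Subtraction of exponents is truncated, so the shift is injective only on monomials containing the
   variable; the product has no others. *)
have supp (S : {set 'I_m}) a : (S, a) \in bsupp (coefw ( *%R (mpolyX (CC R) (mnm1 k))) f) ->
    a k != 0%N.
  rewrite mem_bsupp /bcoef ffunE /= mcoeffXmul; by case: (a k == 0%N); rewrite ?eqxx.
apply: (@jf_norm2_shift _ _ _ (fun i => (i.1, mnm_sub i.2 (mnm1 k)) : bidx m)).
- by rewrite invr_ge0 subr_ge0 ltW.
- move=> [S a] [S' a'] /supp ak /supp ak' /pair_equal_spec[SS aa].
  have {}SS : S = S' := SS; rewrite SS; congr (_, _).
  by rewrite -(mnm_subK ak) -(mnm_subK ak'); congr mnm_add; exact: aa.
move=> [S a] /supp ak; rewrite /bcoef ffunE /= mcoeffXmul (negPf ak).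
rewrite -[in jf_weight _ a](mnm_subK ak) jf_weightD mulrCA.
by rewrite ler_wpM2r ?qnat_le // mulr_ge0 ?sqr_ge0 // ltW // jf_weight_gt0.
Qed.

Lemma rnorm_esgn (k : 'I_m) S : rnorm (esgn R k S) = 1.
Proof. by rewrite /esgn rnormX rnormN rnorm1 expr1n. Qed.

Lemma jf_norm2_ext_mul f k : jf_norm2 (ext_mul k f) <= 1 * jf_norm2 f.
Proof.
have supp (S : {set 'I_m}) a : (S, a) \in bsupp (ext_mul k f) -> k \in S.
  rewrite mem_bsupp /bcoef ffunE /=; case: (k \in S) => //.
  by rewrite mcoeff0 eqxx.
apply: (@jf_norm2_shift _ _ _ (fun i => (i.1 :\ k, i.2) : bidx m)) => //.
  move=> [S a] [S' a'] /supp kS /supp kS' /= [SS ->]; congr (_, _).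
  by rewrite -(finset.setD1K kS) -(finset.setD1K kS') SS.
move=> [S a] /supp kS; rewrite /bcoef ffunE /= kS mcoeffZ rnormM rnorm_esgn.
by rewrite !mul1r.
Qed.

Lemma jf_norm2_ext_ctr f k : jf_norm2 (ext_ctr k f) <= 1 * jf_norm2 f.
Proof.
have supp (S : {set 'I_m}) a : (S, a) \in bsupp (ext_ctr k f) -> k \notin S.
  rewrite mem_bsupp /bcoef ffunE /=; case: (k \in S) => //.
  by rewrite mcoeff0 eqxx.
apply: (@jf_norm2_shift _ _ _ (fun i => (k |: i.1, i.2) : bidx m)) => //.
  move=> [S a] [S' a'] /supp kS /supp kS' /= [SS ->]; congr (_, _).
  by rewrite -(finset.setU1K kS) -(finset.setU1K kS') SS.
move=> [S a] /supp /negPf kS; rewrite /bcoef ffunE /= kS mcoeffZ rnormM rnorm_esgn.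
by rewrite !mul1r.
Qed.

Lemma jf_norm2_diagop f lam : (forall S a, 0 <= lam S a <= 1) ->
  jf_norm2 (diagop lam f) <= 1 * jf_norm2 f.
Proof.
move=> lam1; apply: (@jf_norm2_shift _ _ _ id) => // -[S a] _.
have /andP[l0 l1] := lam1 S a.
rewrite /bcoef mcoeff_diagop mul1r ler_wpM2r //=; first by rewrite ltW // jf_weight_gt0.
by rewrite rnormM rnorm_toC // exprMn ler_piMl ?sqr_ge0 // exprn_ile1.
Qed.

End Weights.

Lemma fin_supp_ell2 (R : realType) (I : countType) (h : I -> CC R) (s : seq I) : uniq s ->
  (forall i, i \notin s -> h i = 0) -> h \in ell2_pred (I := I).
Proof.
move=> us hs; apply/ell2_predP; exists (\sum_(i <- s) rnorm (h i) ^+ 2) => n.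
apply: sum_le_supp => //; first exact: trunc_uniq.
  by move=> i; rewrite sqr_ge0.
by move=> i _ /hs ->; rewrite rnorm0 expr0n.
Qed.

(** * Existence of the completion *)

Section Existence.
Variables (R : realType) (m : nat) (q : R).
Hypotheses (q0 : 0 < q) (q1 : q < 1).
Implicit Types (f g : fpoly R m) (i j : bidx m).

Definition sqrtw i : CC R := toC (Num.sqrt (jf_weight q i.2)).

Lemma sqrtw2 i : sqrtw i * (sqrtw i)^* = toC (jf_weight q i.2).
Proof. by rewrite toC_conj -toCM -expr2 sqr_sqrtr // ltW // jf_weight_gt0. Qed.

Lemma sqrtw_neq0 i : sqrtw i != 0.
Proof.
apply/eqP => i0; have := sqrtw2 i; rewrite i0 mul0r -toC0 => /toC_inj /esym/eqP.
by rewrite gt_eqF // jf_weight_gt0.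
Qed.

(** The coordinate along the normalized basis vector: [sqrtw i] is the norm of the monomial, and the
    weighted form becomes the plain one of l^2. *)
Definition jf_coord f i := sqrtw i * bcoef f i.

Lemma jf_coord_ell2 f : jf_coord f \in ell2_pred (I := bidx m).
Proof.
apply: (fin_supp_ell2 (bsupp_uniq f)) => i.
by rewrite mem_bsupp negbK /jf_coord => /eqP ->; rewrite mulr0.
Qed.

Definition jf_emb f : ell2 R (bidx m) := Ell2 (jf_coord_ell2 f).

Lemma jf_emb_lin : linear jf_emb.
Proof.
move=> c f g; apply/val_inj/funext => i.
rewrite [RHS](ell2_linE c (jf_emb f) (jf_emb g) i) /= /jf_coord bcoef_lin.
by rewrite mulrDr mulrCA.
Qed.

HB.instance Definition _ := GRing.isLinear.Build (CC R) (fpoly R m) (ell2 R (bidx m))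
  *:%R jf_emb jf_emb_lin.

Lemma jf_emb_isom f g : ell2_dot (jf_emb f) (jf_emb g) = jf_dot q f g.
Proof.
have fs i : i \notin bsupp f -> bcoef f i = 0.
  by rewrite mem_bsupp negbK => /eqP.
rewrite (ell2_dot_finite _ (bsupp_uniq f)); last first.
  by move=> i /fs /=; rewrite /jf_coord => ->; rewrite mulr0.
rewrite (jf_dotE _ _ (bsupp_uniq f)) //; apply: eq_bigr => i _ /=.
by rewrite /jf_coord rmorphM /= mulrACA sqrtw2 mulrC.
Qed.

Lemma jf_emb_approx (x : ell2 R (bidx m)) (e : R) : 0 < e ->
  exists f, rnorm (jf_emb f - x) < e.
Proof.
move=> e0; have [M xM] := ell2P x.
have [|N NP] := @monotone_cauchy _ (fun n => sqsum n x) M (sqsum_homo x) xM ((e / 2) ^+ 2).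
  by rewrite exprn_gt0 // divr_gt0.
exists (\sum_(i <- trunc (bidx m) N) ((sqrtw i)^-1 * x i) *: bmono R i).
set p := \sum_(i <- _) _.
have pE i : jf_emb p i = if i \in trunc (bidx m) N then x i else 0.
  rewrite /= /jf_coord bcoef_sum ?trunc_uniq //.
  by case: ifP; rewrite ?mulr0 // mulVKf // sqrtw_neq0.
apply: (@le_lt_trans _ _ (e / 2)); last by lra.
rewrite -(@ler_pXn2r _ 2) ?nnegrE ?rnorm_ge0 ?divr_ge0 ?(ltW e0) //.
(* Enlarging [n] to [maxn n N] makes the truncation contain the first [N] codes, where the error
   vanishes; what remains is the tail of [x] controlled by [NP]. *)
apply: norm_le_sqsum => n; apply: (le_trans (sqsum_homo _ (leq_maxl n N))).
apply/ltW; apply: le_lt_trans (NP N (maxn n N) (leqnn _) (leq_maxr _ _)).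
rewrite lerBrDr /sqsum.
have -> : \sum_(i <- trunc (bidx m) N) rnorm (x i) ^+ 2 =
          \sum_(i <- trunc (bidx m) (maxn n N)) (if i \in trunc (bidx m) N then rnorm (x i) ^+ 2 else 0).
  rewrite -big_mkcond -[RHS]big_filter; apply: perm_big; apply: uniq_perm.
  - exact: trunc_uniq.
  - by rewrite filter_uniq // trunc_uniq.
  move=> i; rewrite mem_filter !mem_trunc; case: ltnP => //= iN.
  by rewrite (leq_trans iN) // leq_maxr.
rewrite -big_split; apply: ler_sum => i _.
rewrite -[leLHS]/(rnorm (jf_emb p i - x i) ^+ 2 +
  if i \in trunc (bidx m) N then rnorm (x i) ^+ 2 else 0) pE.
case: ifP => _; first by rewrite subrr rnorm0 expr0n add0r.
by rewrite sub0r rnormN addr0.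
Qed.

Lemma jf_emb_dense : dense (range jf_emb).
Proof.
move=> O [x Ox] Oo; have /nbhs_rnorm[e e0 eO] : nbhs x O by exact: open_nbhs_nbhs.
have [f fx] := jf_emb_approx x e0; exists (jf_emb f); split; first exact: eO.
by exists f.
Qed.

Lemma hilbert_completion_exists : inhabited (hilbert_completion m q).
Proof.
constructor.
exact: (@HilbertCompletion R m q (ell2 R (bidx m)) (@ell2_dot R (bidx m))
  (@ell2_norm2 R _) jf_emb jf_emb_isom jf_emb_dense).
Qed.

End Existence.

(** * Bounded extension to the completion *)

Section LinearPack.
Variables (K : pzRingType) (U V : lmodType K) (f : U -> V) (fl : linear f).
#[local] HB.instance Definition _ := GRing.isLinear.Build K U V *:%R f fl.
(** Bundles a map whose linearity is established in the middle of a proof. *)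
Definition linear_pack : {linear U -> V} := f.
End LinearPack.

Section CompletionTheory.
Variables (R : realType) (m : nat) (q : R) (H : hilbert_completion m q).
Hypotheses (q0 : 0 < q) (q1 : q < 1).
Local Notation emb := (hc_emb H).
Local Notation dot := (@hc_dot R m q H).
Implicit Types (p f g : fpoly R m) (x y : H) (i j : bidx m).

Lemma dotPl c x x' y : dot (c *: x + x') y = c * dot x y + dot x' y.
Proof. by rewrite linearDl linearZl_LR. Qed.

Lemma dotPr c x x' y : dot y (c *: x + x') = c^* * dot y x + dot y x'.
Proof. by rewrite linearDr linearZr_LR. Qed.

Lemma dotC x y : dot x y = (dot y x)^*.
Proof. by rewrite hermC /= expr0 mul1r. Qed.

Lemma dot0l y : dot 0 y = 0.
Proof. exact: linear0l. Qed.

Lemma dotBl x x' y : dot (x - x') y = dot x y - dot x' y.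
Proof. by rewrite -scaleN1r addrC dotPl mulN1r addrC. Qed.

Lemma dot_norm2 x : dot x x = toC (rnorm x ^+ 2).
Proof. by rewrite -hc_norm rnormE toCX. Qed.

Lemma dot_le x y : rnorm (dot x y) <= rnorm x * rnorm y.
Proof.
rewrite -(@ler_pXn2r _ 2) ?nnegrE ?mulr_ge0 ?rnorm_ge0 //.
by rewrite exprMn -toC_le toCX toCM -!dot_norm2 -rnormE dot_CauchySchwarz.
Qed.

Lemma seq_cvg_dotl (u : nat -> H) x y :
  seq_cvg u x -> seq_cvg (fun n => dot (u n) y) (dot x y).
Proof.
move=> ux e e0; have y0 : 0 < rnorm y + 1 by rewrite ltr_wpDl ?rnorm_ge0.
have [|N NP] := ux (e / (rnorm y + 1)); first by rewrite divr_gt0.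
exists N => n /NP; rewrite -dotBl ltr_pdivlMr //; apply: le_lt_trans.
apply: le_trans (dot_le _ _) _; rewrite ler_wpM2l ?rnorm_ge0 //.
by rewrite lerDl.
Qed.

Lemma seq_cvg_dotr (u : nat -> H) x y :
  seq_cvg u x -> seq_cvg (fun n => dot y (u n)) (dot y x).
Proof.
move=> ux; have := seq_cvg_conj (seq_cvg_dotl y ux); rewrite -dotC.
by under eq_fun do rewrite -dotC.
Qed.

Lemma rnorm_emb2 f : rnorm (emb f) ^+ 2 = jf_norm2 q f.
Proof. by apply: toC_inj; rewrite -dot_norm2 hc_isom jf_dot_norm2. Qed.

Lemma emb_approx x (e : R) : 0 < e -> exists f, rnorm (emb f - x) < e.
Proof.
move=> e0; have [||y [yb [f _ fy]]] := @hc_dense _ _ _ H (ball x (toC e)).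
- by exists x; apply: ballxx; rewrite -toC0 toC_lt.
- by apply: ball_open; rewrite -toC0 toC_lt.
by exists f; rewrite fy; move: yb; rewrite -ball_normE /= rnormE toC_lt rnormB.
Qed.

Lemma emb_seq x : exists p : nat -> fpoly R m, seq_cvg (fun n => emb (p n)) x.
Proof.
have [p pP] := choice (fun n => @emb_approx x n.+1%:R^-1 ltac:(by rewrite invr_gt0 ltr0n)).
exists p => e /inv_succ_lt[N NP]; exists N => n /NP; exact: lt_trans (pP n).
Qed.

Section Extend.
Variables (W : normedModType (CC R)) (Wc : seq_complete W).
Variables (phi : fpoly R m -> W) (phil : linear phi) (M : R) (M0 : 0 <= M).
Hypothesis phiM : forall p, rnorm (phi p) <= M * rnorm (emb p).

Let phiB p p' : phi (p - p') = phi p - phi p'.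
Proof. by have := phil (-1) p' p; rewrite !scaleN1r => E; rewrite addrC E addrC. Qed.

Let phiBM p p' : rnorm (phi p - phi p') <= M * rnorm (emb p - emb p').
Proof. by rewrite -phiB; apply: le_trans (phiM _) _; rewrite raddfB. Qed.

(** Quantifying over all approximating sequences makes the value independent of a choice; linearity
    then follows by combining sequences. *)
Let graph x (y : W) := forall p : nat -> fpoly R m,
  seq_cvg (fun n => emb (p n)) x -> seq_cvg (fun n => phi (p n)) y.

(** Dividing by [M + 1] covers the case [M = 0] and makes the second inequality strict. *)
Let small (e : R) : 0 < e -> 0 < e / (M + 1) /\ M * (e / (M + 1)) < e.
Proof.
move=> e0; have M1 : 0 < M + 1 by rewrite ltr_wpDl.
split; first by rewrite divr_gt0.
by rewrite mulrCA gtr_pMr // ltr_pdivrMr // mul1r ltrDl.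
Qed.

Let graph_ex x : exists y : W, graph x y.
Proof.
have [p px] := emb_seq x.
have [y py] : exists y : W, seq_cvg (fun n => phi (p n)) y.
  apply: Wc => e /small[d0 de].
  have [|N NP] := px (e / (M + 1) / 2); first by rewrite divr_gt0.
  exists N => n k Nn Nk; apply: le_lt_trans (phiBM _ _) _; apply: le_lt_trans de.
  rewrite ler_wpM2l //.
  have -> : emb (p n) - emb (p k) = (emb (p n) - x) + (x - emb (p k)).
    by rewrite addrA subrK.
  apply: le_trans (rnormD _ _) _; rewrite [leRHS]splitr lerD ?ltW ?NP //.
  by rewrite rnormB NP.
exists y => p' p'x e e0.
have [|K KP] := py (e / 2); first by rewrite divr_gt0.
have [d0 de] : 0 < e / 2 / (M + 1) /\ M * (e / 2 / (M + 1)) < e / 2.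
  by apply: small; rewrite divr_gt0.
have [|N NP] := px (e / 2 / (M + 1) / 2); first by rewrite divr_gt0.
have [|N' N'P] := p'x (e / 2 / (M + 1) / 2); first by rewrite divr_gt0.
exists N' => n Nn; pose k := maxn N K.
have -> : phi (p' n) - y = (phi (p' n) - phi (p k)) + (phi (p k) - y).
  by rewrite addrA subrK.
apply: le_lt_trans (rnormD _ _) _; rewrite [e]splitr ltrD ?KP ?leq_maxr //.
apply: le_lt_trans (phiBM _ _) _; apply: le_lt_trans de; rewrite ler_wpM2l //.
have -> : emb (p' n) - emb (p k) = (emb (p' n) - x) + (x - emb (p k)).
  by rewrite addrA subrK.
apply: le_trans (rnormD _ _) _; rewrite [leRHS]splitr lerD ?ltW ?N'P //.
by rewrite rnormB NP ?leq_maxl.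
Qed.

(* [graph] is total and, limits being unique, is the graph of the extension of [phi]. *)
Lemma extend_exists : exists Phi : {linear H -> W},
  (forall x, rnorm (Phi x) <= M * rnorm x) /\ (forall p, Phi (emb p) = phi p).
Proof.
have [F FP] := choice graph_ex.
have Fl : linear F.
  move=> c x x'; have [p px] := emb_seq x; have [p' px'] := emb_seq x'.
  have h1 := seq_cvg_lin c (FP x p px) (FP x' p' px').
  have h2 : seq_cvg (fun n => emb (c *: p n + p' n)) (c *: x + x').
    under eq_fun do rewrite linearP; exact: seq_cvg_lin.
  have := FP _ _ h2; under eq_fun do rewrite phil.
  by move=> h3; exact: seq_cvg_unique h3 h1.
exists (linear_pack Fl); split => [x|p]; last first.
  have pp : seq_cvg (fun=> emb p) (emb p) by apply: (@seq_cvg_eventually _ _ _ _ 0%N).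
  apply: seq_cvg_unique (FP _ _ pp) _.
  by apply: (@seq_cvg_eventually _ _ _ _ 0%N).
have [p px] := emb_seq x; have h1 := seq_cvg_rnorm (FP x p px).
have h2 : (fun n => M * rnorm (emb (p n))) @ \oo --> M * rnorm x.
  by apply: cvgM; [exact: cvg_cst | exact: seq_cvg_rnorm].
rewrite -(cvg_lim (@Rhausdorff R) h1) -(cvg_lim (@Rhausdorff R) h2).
apply: ler_lim.
- by apply/cvg_ex; eexists; exact: h1.
- by apply/cvg_ex; eexists; exact: h2.
by exists 0%N => // n _ /=; exact: phiM.
Qed.

End Extend.

(** A class closed under composition, finite sums and [f - T f]: every operator of the theorem is
    assembled from q-derivatives, multiplications by a variable, [ext_mul], [ext_ctr] and diagonal
    operators. *)
Definition jf_bounded (T : fpoly R m -> fpoly R m) : Prop :=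
  linear T /\ exists2 M : R, 0 <= M & forall p, rnorm (emb (T p)) <= M * rnorm (emb p).

Lemma jf_bounded_norm2 T C : linear T -> 0 <= C ->
  (forall f, jf_norm2 q (T f) <= C * jf_norm2 q f) -> jf_bounded T.
Proof.
move=> Tl C0 TC; split => //; exists (Num.sqrt C) => [|p]; first exact: sqrtr_ge0.
rewrite -(@ler_pXn2r _ 2) ?nnegrE ?mulr_ge0 ?sqrtr_ge0 ?rnorm_ge0 //.
by rewrite exprMn !rnorm_emb2 sqr_sqrtr.
Qed.

Lemma jf_bounded_comp T T' : jf_bounded T -> jf_bounded T' -> jf_bounded (T \o T').
Proof.
move=> [Tl [M M0 TM]] [Tl' [M' M'0 TM']]; split; first by move=> c f g /=; rewrite Tl' Tl.
exists (M * M') => [|p /=]; first exact: mulr_ge0.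
by apply: le_trans (TM _) _; rewrite -mulrA ler_wpM2l.
Qed.

Lemma jf_bounded_sum (n : nat) (T : 'I_n -> fpoly R m -> fpoly R m) :
  (forall k, jf_bounded (T k)) -> jf_bounded (fun f => \sum_k T k f).
Proof.
move=> Tb; split=> [c f g|].
  by rewrite scaler_sumr -big_split; apply: eq_bigr => k _; rewrite (Tb k).1.
have MP k : exists M : R, 0 <= M /\ forall p, rnorm (emb (T k p)) <= M * rnorm (emb p).
  by have [_ [M M0 TM]] := Tb k; exists M.
have [M {}MP] := choice MP; exists (\sum_k M k).
  by apply: sumr_ge0 => k _; have [] := MP k.
move=> p; rewrite raddf_sum mulr_suml; apply: le_trans (rnorm_sum _ _ _) _.
by apply: ler_sum => k _; have [_] := MP k; apply.
Qed.

Lemma jf_bounded_id_sub T : jf_bounded T -> jf_bounded (fun f => f - T f).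
Proof.
move=> [Tl [M M0 TM]]; split=> [c f g|].
  by rewrite Tl scalerBr opprD addrACA.
exists (1 + M) => [|p]; first by rewrite addr_ge0.
rewrite raddfB; apply: le_trans (rnormD _ _) _.
by rewrite rnormN mulrDl mul1r lerD2l; exact: TM.
Qed.

Lemma jf_bounded_extends T : jf_bounded T ->
  exists That : {linear H -> H}, bounded_extension T That.
Proof.
move=> [Tl [M M0 TM]].
have [|That [TM' TE]] := extend_exists (@complete_seq_complete R H) _ M0 TM.
  by move=> c f g; rewrite Tl linearP.
exists That; split=> //; exists M => x.
by rewrite !rnormE -toCM toC_le.
Qed.

Lemma jf_bounded_qderiv k : jf_bounded (coefw (qderiv q k)).
Proof.
apply: (@jf_bounded_norm2 _ (1 - q)^-1).
- by apply: coefw_lin; exact: qderiv_lin.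
- by rewrite invr_ge0 subr_ge0 ltW.
- by move=> f; exact: jf_norm2_qderiv.
Qed.

Lemma jf_bounded_mulX k : jf_bounded (coefw ( *%R (mpolyX (CC R) (mnm1 k)))).
Proof.
apply: (@jf_bounded_norm2 _ (1 - q)^-1).
- by apply: coefw_lin; exact: mul_lin.
- by rewrite invr_ge0 subr_ge0 ltW.
- by move=> f; exact: jf_norm2_mulX.
Qed.

Lemma jf_bounded_ext_mul k : jf_bounded (ext_mul k).
Proof.
apply: (@jf_bounded_norm2 _ 1) => //; first exact: ext_mul_lin.
by move=> f; exact: jf_norm2_ext_mul.
Qed.

Lemma jf_bounded_ext_ctr k : jf_bounded (ext_ctr k).
Proof.
apply: (@jf_bounded_norm2 _ 1) => //; first exact: ext_ctr_lin.
by move=> f; exact: jf_norm2_ext_ctr.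
Qed.

Lemma diagop_lin (lam : {set 'I_m} -> multinom (m + m) -> R) : linear (diagop lam).
Proof.
move=> c f g; apply: bcoefP => -[S a].
by rewrite bcoef_lin /bcoef /= !mcoeff_diagop !ffunE mcoeffD mcoeffZ mulrDr mulrCA.
Qed.

Lemma jf_bounded_diagop lam : (forall S a, 0 <= lam S a <= 1) -> jf_bounded (diagop lam).
Proof.
move=> lam1; apply: (@jf_bounded_norm2 _ 1) => //; first exact: diagop_lin.
by move=> f; exact: jf_norm2_diagop.
Qed.

(** If some [n k] is nonzero, that summand alone is at least 1; otherwise the sum is 0 and so is its
    inverse. Both generalized inverses are thus contractions. *)
Lemma sum_qnat_inv (n : 'I_m -> nat) : 0 <= (\sum_k qnat q (n k))^-1 <= 1.
Proof.
have s0 : 0 <= \sum_k qnat q (n k) by apply: sumr_ge0 => k _; exact: qnat_ge0.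
rewrite invr_ge0 s0 /=; have [k nk|n0] := pickP (fun k => n k != 0%N).
  rewrite invf_le1; last first.
    apply: lt_le_trans ltr01 _.
    rewrite (bigD1 k) //= ler_wpDr ?sumr_ge0 // => [l _|]; first exact: qnat_ge0.
    by case: (n k) nk => // l _; exact: qnat_ge1.
  rewrite (bigD1 k) //= ler_wpDr ?sumr_ge0 // => [l _|]; first exact: qnat_ge0.
  by case: (n k) nk => // l _; exact: qnat_ge1.
rewrite big1 ?invr0 // => k _; have /negbFE/eqP -> := n0 k.
exact: qnat0.
Qed.

Lemma jf_bounded_Apinv : jf_bounded (@Apinv R m q).
Proof. by apply: jf_bounded_diagop => S a; exact: sum_qnat_inv. Qed.

Lemma jf_bounded_Bpinv : jf_bounded (@Bpinv R m q).
Proof. by apply: jf_bounded_diagop => S a; exact: sum_qnat_inv. Qed.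

Lemma jf_bounded_Dq : jf_bounded (@Dq R m q).
Proof.
apply: (@jf_bounded_sum m (fun k => ext_mul k \o coefw (qderiv q (lshift m k)))) => k.
exact: jf_bounded_comp (jf_bounded_ext_mul k) (jf_bounded_qderiv _).
Qed.

Lemma jf_bounded_Dqdag : jf_bounded (@Dqdag R m q).
Proof.
apply: (@jf_bounded_sum m (fun k => ext_ctr k \o coefw (qderiv q (rshift m k)))) => k.
exact: jf_bounded_comp (jf_bounded_ext_ctr k) (jf_bounded_qderiv _).
Qed.

Lemma jf_bounded_Zop : jf_bounded (@Zop R m).
Proof.
apply: (@jf_bounded_sum m (fun k => ext_ctr k \o coefw ( *%R (zvar R k)))) => k.
exact: jf_bounded_comp (jf_bounded_ext_ctr k) (jf_bounded_mulX _).
Qed.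

Lemma jf_bounded_Zdag : jf_bounded (@Zdag R m).
Proof.
apply: (@jf_bounded_sum m (fun k => ext_mul k \o coefw ( *%R (wvar R k)))) => k.
exact: jf_bounded_comp (jf_bounded_ext_mul k) (jf_bounded_mulX _).
Qed.

Lemma jf_bounded_Qz : jf_bounded (@Qz R m q).
Proof.
exact: jf_bounded_comp jf_bounded_Zop (jf_bounded_comp jf_bounded_Apinv jf_bounded_Dq).
Qed.

Lemma jf_bounded_Qw : jf_bounded (@Qw R m q).
Proof.
exact: jf_bounded_comp jf_bounded_Zdag (jf_bounded_comp jf_bounded_Bpinv jf_bounded_Dqdag).
Qed.

Lemma closed_subspace_ker (T : {linear H -> H}) (M : R) :
  (forall x, `|T x| <= toC M * `|x|) -> closed_subspace (opker T).
Proof.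
move=> TM; split; rewrite /opker /=.
- exact: linear0.
- by move=> c x y /= x0 y0; rewrite linearP x0 y0 scaler0 addr0.
move=> x xcl /=; apply: rnorm_eq0; rewrite leNgt; apply/negP => Tx0.
(* The sign of [M] is not given, hence the positive bound [|M| + 1]. A point of the kernel within
   [d] of [x] would force the norm of [T x] below itself. *)
pose d := rnorm (T x) / (`|M| + 1).
have M1 : 0 < `|M| + 1 by rewrite ltr_wpDl.
have d0 : 0 < d by rewrite divr_gt0.
have [|y [/= Ty yx]] := xcl [set y | rnorm (y - x) < d].
  by apply/nbhs_rnorm; exists d.
have : rnorm (T x) <= M * rnorm (y - x).
  by rewrite -toC_le toCM -!rnormE -normrN -[- T x]add0r -Ty -linearB.
rewrite leNgt => /negP; apply; apply: (@le_lt_trans _ _ (`|M| * d)).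
  by apply: (@le_trans _ _ (`|M| * rnorm (y - x)));
    rewrite ?ler_wpM2r ?rnorm_ge0 ?ler_norm // ler_wpM2l // ltW.
by rewrite /d mulrCA gtr_pMr // ltr_pdivrMr // mul1r ltrDl.
Qed.

Lemma closed_subspaceI (E F : set H) :
  closed_subspace E -> closed_subspace F -> closed_subspace (E `&` F).
Proof.
move=> [E0 EP Ec] [F0 FP Fc]; split => //; last exact: closedI.
by move=> c x y [Ex Fx] [Ey Fy]; split; [exact: EP | exact: FP].
Qed.

End CompletionTheory.

(** * The q-exponential and kernel polynomials *)

Section QExponential.
Variables (R : realType) (q : R).
Hypotheses (q0 : 0 < q) (q1 : q < 1).

Definition rqexp (r : R) (N : nat) : R := \sum_(n < N) r ^+ n / qfact q n.

Definition cqexp (t : CC R) (N : nat) : CC R := \sum_(n < N) t ^+ n / toC (qfact q n).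

Lemma rqexp_term_ge0 r n : 0 <= r -> 0 <= r ^+ n / qfact q n.
Proof. by move=> r0; rewrite divr_ge0 ?exprn_ge0 // ltW // qfact_gt0. Qed.

Lemma rqexpS r N : rqexp r N.+1 = rqexp r N + r ^+ N / qfact q N.
Proof. by rewrite /rqexp big_ord_recr. Qed.

Lemma rqexp_homo r : 0 <= r -> {homo rqexp r : n k / (n <= k)%N >-> n <= k}.
Proof.
move=> r0; apply: homo_leq => [||n]; [exact: lexx|exact: le_trans|].
by rewrite rqexpS lerDl rqexp_term_ge0.
Qed.

(* Past the point where the ratio of consecutive terms is at most [rho < 1],
   the quantity [rqexp r N + u N / (1 - rho)] is nonincreasing. *)
Lemma rqexp_bounded r : 0 <= r -> r < (1 - q)^-1 -> exists M, forall N, rqexp r N <= M.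
Proof.
move=> r0 rq; pose c := r * (1 - q); pose rho := (1 + c) / 2.
have q1' : 0 < 1 - q by rewrite subr_gt0.
have c0 : 0 <= c by rewrite mulr_ge0 // ltW.
have c1 : c < 1 by rewrite /c -ltr_pdivlMr // div1r.
have rho1 : rho < 1 by rewrite /rho ltr_pdivrMr //; lra.
have rho0 : 0 < rho by rewrite /rho divr_gt0 //; lra.
have crho : c < rho by rewrite /rho ltr_pdivlMr //; lra.
have [N0 NP] : exists N0 : nat, forall n, (N0 <= n)%N -> c <= rho * (1 - q ^+ n.+1).
  have /cvgrPdist_lt/(_ (1 - c / rho)) : (fun n => q ^+ n) @ \oo --> (0 : R).
    by apply: cvg_expr; rewrite ger0_norm // ltW.
  case=> [|N0 _ NP]; first by rewrite subr_gt0 ltr_pdivrMr // mul1r.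
  exists N0 => n Nn; have /= := NP n.+1 (leq_trans Nn (leqnSn n)).
  rewrite sub0r normrN ger0_norm ?exprn_ge0 ?(ltW q0) // => h.
  have {h} : c / rho < 1 - q ^+ n.+1 by lra.
  by rewrite ltr_pdivrMr // mulrC => /ltW.
pose u n := r ^+ n / qfact q n.
have uS n : (N0 <= n)%N -> u n.+1 <= rho * u n.
  move=> /NP cn; have qn := qfact_gt0 q0 q1 n.
  have qq : 0 < qnat q n.+1 by apply: lt_le_trans ltr01 _; exact: qnat_ge1.
  have -> : u n.+1 = (r / qnat q n.+1) * u n.
    by rewrite /u qfactS exprS [qfact q n * _]mulrC -mulf_div.
  apply: ler_wpM2r; first exact: rqexp_term_ge0.
  rewrite ler_pdivrMr // /qnat mulrA ler_pdivlMr //.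
have LP j : rqexp r (N0 + j) + u (N0 + j)%N / (1 - rho) <= rqexp r N0 + u N0 / (1 - rho).
  elim: j => [|j IH]; first by rewrite addn0.
  apply: le_trans IH; rewrite addnS rqexpS -addrA lerD2l -/(u _).
  have := uS _ (leq_addr j N0); set a := u _; set b := u _ => ba.
  have rr : 0 < 1 - rho by rewrite subr_gt0.
  rewrite -(ler_pM2r rr) mulrDl !divfK ?gt_eqF //; nra.
exists (rqexp r N0 + u N0 / (1 - rho)) => N.
apply: le_trans (LP N); apply: (@le_trans _ _ (rqexp r (N0 + N))).
  by apply: rqexp_homo => //; exact: leq_addl.
by rewrite lerDl divr_ge0 ?rqexp_term_ge0 // subr_ge0 ltW.
Qed.

Lemma cqexp_diff t n k : (n <= k)%N ->
  rnorm (cqexp t k - cqexp t n) <= rqexp (rnorm t) k - rqexp (rnorm t) n.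
Proof.
move=> /subnKC <-; elim: (k - n)%N => [|j IH].
  by rewrite addn0 !subrr rnorm0.
rewrite addnS rqexpS /cqexp big_ord_recr /= -/(cqexp _ _) addrAC [leRHS]addrAC.
apply: le_trans (rnormD _ _) _; apply: lerD => //.
by rewrite -toCV rnormM rnormX rnorm_toC // invr_ge0 ltW // qfact_gt0.
Qed.

Lemma cqexp_cvg t : rnorm t < (1 - q)^-1 -> seq_cvg (cqexp t) (qexp q t).
Proof.
move=> tq; have [M MP] := rqexp_bounded (rnorm_ge0 t) tq.
have [l tl] : exists l, seq_cvg (cqexp t) l.
  apply: CC_seq_complete => e e0.
  have [N NP] := monotone_cauchy (rqexp_homo (rnorm_ge0 t)) MP e0.
  have H n k : (N <= n)%N -> (n <= k)%N -> rnorm (cqexp t k - cqexp t n) < e.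
    by move=> Nn nk; apply: le_lt_trans (cqexp_diff t nk) _; exact: NP.
  exists N => n k Nn Nk; case/orP: (leq_total n k) => nk; last exact: H.
  by rewrite rnormB H.
suff -> : qexp q t = l by [].
rewrite /qexp; apply: cvg_lim; first exact: norm_hausdorff.
have -> : series (fun n => t ^+ n / toC (qfact q n)) = cqexp t.
  by apply/funext => n; rewrite /series /cqexp /= big_mkord.
exact/seq_cvgP.
Qed.

End QExponential.

Section Kernel.
Variables (R : realType) (m : nat) (q : R).
Hypotheses (q0 : 0 < q) (q1 : q < 1).
Implicit Types (x y : Defs.point R m) (S : {set 'I_m}) (a : multinom (m + m)).

(** Merges the z and w coordinates, in the order of the polynomial variables, so that all of them
    are treated alike. *)
Definition coord x (k : 'I_(m + m)) : CC R := row_mx x.1 x.2 0 k.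

Definition monom x a : CC R := \prod_k coord x k ^+ a k.

Definition radius : R := (Num.sqrt (1 - q))^-1.

Lemma radius_gt0 : 0 < radius.
Proof. by rewrite invr_gt0 sqrtr_gt0 subr_gt0. Qed.

Lemma radius2 : radius * radius = (1 - q)^-1.
Proof. by rewrite /radius -invfM -expr2 sqr_sqrtr // subr_ge0 ltW. Qed.

Lemma OmegaP x : Omega q x <-> forall k, rnorm (coord x k) < radius.
Proof.
split=> [xO k|xk i].
  rewrite /coord -(splitK k) -toC_lt -rnormE; case: (fintype.split k) => i /=.
    by rewrite row_mxEl; exact: (xO i).1.
  by rewrite row_mxEr; exact: (xO i).2.
split; rewrite rnormE toC_lt.
  by have := xk (lshift m i); rewrite /coord row_mxEl.
by have := xk (rshift m i); rewrite /coord row_mxEr.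
Qed.

Lemma Omega_prod x y k : Omega q x -> Omega q y ->
  rnorm (coord x k) * rnorm (coord y k) < (1 - q)^-1.
Proof.
move=> /OmegaP/(_ k) xk /OmegaP/(_ k) yk; rewrite -radius2.
by rewrite ltr_pM ?rnorm_ge0.
Qed.

Definition box_mnm N (f : {ffun 'I_(m + m) -> 'I_N}) : multinom (m + m) :=
  Multinom [tuple (f k : nat) | k < m + m].

(** Truncation by the largest exponent rather than by the total degree: a sum over a box factors
    into partial sums of one-variable q-exponentials. *)
Definition box N S : seq (bidx m) := [seq ((S, box_mnm f) : bidx m) | f : {ffun 'I_(m + m) -> 'I_N}].

Lemma box_mnmE N f k : @box_mnm N f k = f k.
Proof. by rewrite /box_mnm mnmE. Qed.

Lemma box_uniq N S : uniq (box N S).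
Proof.
rewrite map_inj_uniq ?enum_uniq // => f g /pair_equal_spec[_ fg].
apply/ffunP => k; apply: val_inj => /=.
by rewrite -!box_mnmE fg.
Qed.

Lemma mem_box N S i : (i \in box N S) = (i.1 == S) && [forall k, (i.2 k < N)%N].
Proof.
case: i => T a /=; apply/mapP/andP => [[f _ /pair_equal_spec[-> ->]]|[/eqP -> /forallP aN]].
  by split=> //; apply/forallP => k; rewrite box_mnmE.
exists [ffun k => Ordinal (aN k)]; first by rewrite mem_enum.
congr (_, _); apply/mnmP => k.
by rewrite box_mnmE ffunE.
Qed.

Lemma box_sub N N' S i : (N <= N')%N -> i \in box N S -> i \in box N' S.
Proof.
move=> NN; rewrite !mem_box => /andP[-> /forallP aN] /=.
by apply/forallP => k; exact: leq_trans (aN k) NN.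
Qed.

(** Division by the squared norm of the monomial cancels the weight in the form. The conjugate is
    undone by the conjugate-linear second argument, so pairing returns the monomial at [x]. *)
Definition kcoef x (i : bidx m) : CC R := (monom x i.2)^* / toC (jf_weight q i.2).

Definition kpoly N S x : fpoly R m := \sum_(i <- box N S) kcoef x i *: bmono R i.

Lemma bcoef_kpoly N S x i : bcoef (kpoly N S x) i = if i \in box N S then kcoef x i else 0.
Proof. exact/bcoef_sum/box_uniq. Qed.

Lemma box_sum_prod N S x y :
  \sum_(i <- box N S) kcoef x i * monom y i.2 =
  \prod_k cqexp q (coord y k * (coord x k)^*) N.
Proof.
rewrite /cqexp bigA_distr_bigA /box big_map big_enum /=; apply: eq_bigr => f _.
rewrite /kcoef /= /monom jf_weightE toC_prod rmorph_prod -prodfV -!big_split /=.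
apply: eq_bigr => k _; rewrite box_mnmE rmorphXn /= exprMn.
by rewrite mulrC mulrA.
Qed.

Lemma jf_dot_kpoly (f : fpoly R m) N S y :
  jf_dot q f (kpoly N S y) = \sum_(i <- box N S) bcoef f i * monom y i.2.
Proof.
pose s := undup (bsupp f ++ box N S).
rewrite (@jf_dotE _ _ _ s) ?undup_uniq //; last first.
  by move=> i; rewrite mem_undup mem_cat negb_or mem_bsupp negbK => /andP[/eqP].
have E i : i \in box N S ->
    bcoef f i * (bcoef (kpoly N S y) i)^* * toC (jf_weight q i.2) = bcoef f i * monom y i.2.
  move=> iB; rewrite bcoef_kpoly iB /kcoef rmorphM fmorphV /= conjCK toC_conj.
  rewrite -!mulrA mulVf ?mulr1 // -toC0 (inj_eq (@toC_inj R)) gt_eqF //.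
  exact: jf_weight_gt0.
rewrite (@sum_eq_supp _ _ s (box N S)) ?undup_uniq ?box_uniq //; first last.
- by move=> i iB; rewrite mem_undup mem_cat iB orbT.
- by move=> i _ iB; rewrite bcoef_kpoly (negPf iB) conjC0 mulr0 mul0r.
by rewrite big_seq [RHS]big_seq; exact: eq_bigr.
Qed.

(** Boxes with the same [S] are nested, so the pairing sees only the smaller one and is independent
    of [N']. *)
Lemma jf_dot_kpoly2 N N' S T x y : (N <= N')%N ->
  jf_dot q (kpoly N S x) (kpoly N' T y) =
  if S == T then \prod_k cqexp q (coord y k * (coord x k)^*) N else 0.
Proof.
move=> NN; rewrite jf_dot_kpoly; case: (eqVneq S T) => [<-|ST].
  rewrite -(box_sum_prod N S) (@sum_eq_supp _ _ _ (box N S)) ?box_uniq //.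
  - rewrite big_seq [RHS]big_seq; apply: eq_bigr => i iB.
    by rewrite bcoef_kpoly iB.
  - by move=> i _ iB; rewrite bcoef_kpoly (negPf iB) mul0r.
  - by move=> i iB; rewrite (box_sub NN iB).
rewrite big_seq big1 // => i iB; rewrite bcoef_kpoly ifN ?mul0r //.
by move: iB; rewrite !mem_box => /andP[/eqP -> _]; rewrite eq_sym (negPf ST).
Qed.

Lemma peval_sum (f : fpoly R m) x S :
  peval f x S = \sum_(a <- msupp (f S)) bcoef f (S, a) * monom x a.
Proof. by rewrite ffunE mevalE. Qed.

Lemma jf_dot_kpoly_peval (f : fpoly R m) S y :
  exists N0 : nat, forall N, (N0 <= N)%N -> jf_dot q f (kpoly N S y) = peval f y S.
Proof.
exists (\max_(a <- msupp (f S)) \max_k (a k).+1) => N NN.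
rewrite jf_dot_kpoly peval_sum.
rewrite -(big_map (fun a => (S, a) : bidx m) xpredT (fun i => bcoef f i * monom y i.2)).
apply: sum_eq_supp.
- exact: box_uniq.
- by rewrite map_inj_uniq ?msupp_uniq // => a b [].
- move=> i; rewrite mem_box => /andP[/eqP iS _] im.
  suff -> : bcoef f i = 0 by rewrite mul0r.
  apply/eqP; rewrite -[_ == _]negbK -mem_bsupp; apply: contra im.
  case: i iS => T a /= -> /allpairsPdep[T' [a' [_ a'm /pair_equal_spec[-> ->]]]].
  exact: map_f.
- move=> i /mapP[a am ->]; rewrite mem_box eqxx /= => /negP[]; apply/forallP => k.
  apply: leq_trans NN.
  apply: leq_trans (@leq_bigmax_seq _ (msupp (f S)) xpredT
    (fun b : multinom (m + m) => \max_k (b k).+1) a am isT).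
  exact: (@leq_bigmax _ (fun k => (a k).+1) k).
Qed.

End Kernel.

(** * Jets of polynomials *)

Section JetAlgebra.
Variable K : comNzRingType.
Implicit Types a b c e h : K.

Lemma jet_algebra1 h a a' b b' : h * (b * a' + a * b') = a * (h * b') + h * b * a'.
Proof. by ring. Qed.

(** Product rule for second-order remainders: [e], [a], [b] stand for the value at [v + h], the
    value at [v] and the linear part of one factor. *)
Lemma jet_algebra2 e e' a a' b b' : e * e' - a * a' - (a * b' + b * a') =
  a * (e' - a' - b') + (e - a - b) * a' + (b * b' + b * (e' - a' - b') +
    (e - a - b) * b' + (e - a - b) * (e' - a' - b')).
Proof. by ring. Qed.

Lemma jet_algebra3 c e e' a a' b b' :
  c * e + e' - (c * a + a') - (c * b + b') = c * (e - a - b) + (e' - a' - b').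
Proof. by ring. Qed.

Lemma jet_algebra4 c h a b : h * (c * a + b) = c * (h * a) + h * b.
Proof. by ring. Qed.

End JetAlgebra.

(** In the product on the right, [b * c'] and [c * b'] carry [T ^+ 3] and [c * c'] carries [T ^+ 4];
    as [T >= 1], these dominate the weight [T ^+ 2] given to them on the left. *)
Lemma jet_estimate (R : realType) (T U V a b c a' b' c' : R) : 1 <= T ->
  0 <= a -> 0 <= b -> 0 <= c -> 0 <= a' -> 0 <= b' -> 0 <= c' ->
  U <= a * b' + b * a' ->
  V <= a * c' + c * a' + (b * b' + b * c' + c * b' + c * c') ->
  a * a' + T * U + T ^+ 2 * V <= (a + T * b + T ^+ 2 * c) * (a' + T * b' + T ^+ 2 * c').
Proof.
move=> T1 a0 b0 c0 a'0 b'0 c'0 h1 h2.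
have T0 : 0 <= T by apply: le_trans T1.
have k1 : T * U <= T * (a * b' + b * a') by rewrite ler_wpM2l.
have k2 := ler_wpM2l (sqr_ge0 T) h2.
apply: (@le_trans _ _ (a * a' + T * (a * b' + b * a') + T ^+ 2 * (a * c' + c * a' +
  (b * b' + b * c' + c * b' + c * c')))); first by rewrite !lerD.
rewrite -subr_ge0.
have -> : (a + T * b + T ^+ 2 * c) * (a' + T * b' + T ^+ 2 * c') -
   (a * a' + T * (a * b' + b * a') + T ^+ 2 *
   (a * c' + c * a' + (b * b' + b * c' + c * b' + c * c'))) =
   T ^+ 2 * ((T - 1) * (b * c' + c * b') + (T ^+ 2 - 1) * (c * c')) by ring.
have T1' : 0 <= T - 1 by rewrite subr_ge0.
have T2' : 0 <= T ^+ 2 - 1 by rewrite subr_ge0 expr_ge1.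
by rewrite mulr_ge0 ?sqr_ge0 // addr_ge0 // mulr_ge0 // ?addr_ge0 // mulr_ge0.
Qed.

Lemma jet_estimate_lin (R : realType) (T A B C k a b c a' b' c' : R) : 0 <= T ->
  A <= k * a + a' -> B <= k * b + b' -> C <= k * c + c' ->
  A + T * B + T ^+ 2 * C <= k * (a + T * b + T ^+ 2 * c) + (a' + T * b' + T ^+ 2 * c').
Proof.
move=> T0 hA hB hC.
have -> : k * (a + T * b + T ^+ 2 * c) + (a' + T * b' + T ^+ 2 * c') =
  k * a + a' + T * (k * b + b') + T ^+ 2 * (k * c + c') by ring.
by rewrite !lerD // ler_wpM2l // sqr_ge0.
Qed.

Section Jets.
Variables (R : realType) (n : nat) (v h : 'I_n -> CC R) (T : R).
Hypothesis T1 : 1 <= T.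
Implicit Types p s : mpoly n (CC R).

(* The value of [p] at [v], the part of [p (v + h)] linear in [h], and the remainder. *)
Definition jet0 p : CC R := meval v p.
Definition jet1 p : CC R := \sum_k h k * meval v (mderiv k p).
Definition jet2 p : CC R := meval (fun k => v k + h k) p - jet0 p - jet1 p.

Definition jet_norm p : R := rnorm (jet0 p) + T * rnorm (jet1 p) + T ^+ 2 * rnorm (jet2 p).

Lemma jet1M p s : jet1 (p * s) = jet0 p * jet1 s + jet1 p * jet0 s.
Proof.
rewrite /jet1 /jet0 mulr_sumr mulr_suml -big_split; apply: eq_bigr => k _ /=.
by rewrite mderivM mevalD !mevalM jet_algebra1.
Qed.

Lemma jet2M p s : jet2 (p * s) = jet0 p * jet2 s + jet2 p * jet0 s +
  (jet1 p * jet1 s + jet1 p * jet2 s + jet2 p * jet1 s + jet2 p * jet2 s).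
Proof. by rewrite /jet2 jet1M [jet0 (p * s)]mevalM mevalM jet_algebra2. Qed.

Lemma jet_normM p s : jet_norm (p * s) <= jet_norm p * jet_norm s.
Proof.
rewrite /jet_norm jet1M jet2M [jet0 (p * s)]mevalM rnormM -/(jet0 p) -/(jet0 s).
set a := jet0 p; set a' := jet0 s; set b := jet1 p; set b' := jet1 s.
set c := jet2 p; set c' := jet2 s.
have h1 : rnorm (a * b' + b * a') <= rnorm a * rnorm b' + rnorm b * rnorm a'.
  by rewrite -!rnormM rnormD.
have h2 : rnorm (a * c' + c * a' + (b * b' + b * c' + c * b' + c * c')) <=
    rnorm a * rnorm c' + rnorm c * rnorm a' + (rnorm b * rnorm b' + rnorm b * rnorm c'
      + rnorm c * rnorm b' + rnorm c * rnorm c').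
  rewrite -!rnormM.
  by do 5 (apply: le_trans (rnormD _ _) _; apply: lerD => //); rewrite ?lexx ?rnormD //.
apply: jet_estimate => //; exact: rnorm_ge0.
Qed.

Lemma jet_norm_ge0 p : 0 <= jet_norm p.
Proof.
have T0 : 0 <= T by apply: le_trans T1.
by rewrite !addr_ge0 ?mulr_ge0 ?rnorm_ge0 ?sqr_ge0.
Qed.

Lemma jet_norm_lin c p s : jet_norm (c *: p + s) <= rnorm c * jet_norm p + jet_norm s.
Proof.
have e0 : jet0 (c *: p + s) = c * jet0 p + jet0 s by rewrite /jet0 mevalD mevalZ.
have e1 : jet1 (c *: p + s) = c * jet1 p + jet1 s.
  rewrite /jet1 mulr_sumr -big_split; apply: eq_bigr => k _ /=.
  by rewrite mderivD mderivZ mevalD mevalZ jet_algebra4.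
have e2 : jet2 (c *: p + s) = c * jet2 p + jet2 s.
  by rewrite /jet2 e0 e1 mevalD mevalZ jet_algebra3.
have N a b : rnorm (c * a + b) <= rnorm c * rnorm a + rnorm b.
  by apply: le_trans (rnormD _ _) _; rewrite rnormM.
rewrite /jet_norm e0 e1 e2.
have T0 : 0 <= T by apply: le_trans T1.
by apply: jet_estimate_lin.
Qed.

Lemma jet_norm0 : jet_norm 0 = 0.
Proof.
have j1 : jet1 0 = 0 by apply: big1 => k _; rewrite mderiv0 meval0 mulr0.
by rewrite /jet_norm /jet2 j1 /jet0 !meval0 !subrr !rnorm0 !mulr0 !addr0.
Qed.

Lemma jet_norm1 : jet_norm 1 = 1.
Proof.
have j1 : jet1 1 = 0.
  by apply: big1 => k _; rewrite -[1]/(mpolyC n (1 : CC R)) mderivC meval0 mulr0.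
by rewrite /jet_norm /jet2 j1 /jet0 !meval1 subrr subr0 rnorm0 rnorm1 !mulr0 !addr0.
Qed.

Lemma jet_normX k : jet_norm (mpolyX (CC R) (mnm1 k)) = rnorm (v k) + T * rnorm (h k).
Proof.
have j1 : jet1 (mpolyX (CC R) (mnm1 k)) = h k.
  rewrite /jet1 (bigD1 k) //= big1 ?addr0 => [|l lk].
    rewrite mderivX mnm1E eqxx scale1r.
    rewrite (_ : mnm_sub _ _ = @mnm0 n) ?mpolyX0 ?meval1 ?mulr1 //.
    by apply/mnmP => l; rewrite mnmBE subnn mnm0E.
  by rewrite mderivX mnm1E eq_sym (negPf lk) scale0r meval0 mulr0.
rewrite /jet_norm /jet2 j1 /jet0 !mevalXU [v k + h k]addrC addrK subrr.
by rewrite rnorm0 mulr0 addr0.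
Qed.

Lemma jet_norm_mnm (r : 'I_n -> R) a :
  (forall k, rnorm (v k) + T * rnorm (h k) <= r k) ->
  jet_norm (mpolyX (CC R) a) <= \prod_k r k ^+ a k.
Proof.
move=> vr; rewrite mpolyXE_id.
elim: (index_enum 'I_n) => [|k s IH]; first by rewrite !big_nil jet_norm1.
rewrite !big_cons; apply: le_trans (jet_normM _ _) _.
apply: ler_pM => //; try exact: jet_norm_ge0.
elim: (a k) => [|j IHj]; first by rewrite !expr0 jet_norm1.
rewrite !exprS; apply: le_trans (jet_normM _ _) _.
apply: ler_pM => //; try exact: jet_norm_ge0.
by rewrite jet_normX.
Qed.

(** Submultiplicativity reduces a monomial to its variables, whose jet norms are [|v_k| + T |h_k|].
    Value, linear part and remainder are thus controlled together by the majorant of [p] at [r]. *)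
Lemma jet_norm_le (r : 'I_n -> R) p :
  (forall k, rnorm (v k) + T * rnorm (h k) <= r k) ->
  jet_norm p <= \sum_(a <- msupp p) rnorm (mcoeff a p) * \prod_k r k ^+ a k.
Proof.
move=> vr; rewrite {1}(mpolyE p).
elim: (msupp p) => [|a s IH]; first by rewrite !big_nil jet_norm0.
rewrite !big_cons; apply: le_trans (jet_norm_lin _ _ _) _.
by apply: lerD => //; rewrite ler_wpM2l ?rnorm_ge0 // jet_norm_mnm.
Qed.

End Jets.

(** * Differentiability from a quadratic remainder *)

Section QuadraticRemainder.
Variables (R : realType) (V : normedModType (CC R)) (F : V -> CC R) (x : V).
Variables (L : {linear V -> CC R}) (M C d : R).
Hypotheses (LM : forall h, rnorm (L h) <= M * rnorm h) (C0 : 0 <= C) (d0 : 0 < d).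
Hypothesis FL : forall h, rnorm h <= d -> rnorm (F (x + h) - F x - L h) <= C * rnorm h ^+ 2.

(** The bound on [L] supplies its continuity and the quadratic remainder is o(h); uniqueness of the
    differential then identifies it with [L]. *)
Lemma differentiable_quadratic : differentiable F x.
Proof.
have Lc : continuous L.
  move=> y A /nbhs_rnorm[e e0 eA]; apply/nbhs_rnorm.
  have M1 : 0 < `|M| + 1 by rewrite ltr_wpDl.
  exists (e / (`|M| + 1)) => [|z]; first by rewrite divr_gt0.
  rewrite ltr_pdivlMr // => zy; apply: eA; rewrite -linearB.
  apply: le_lt_trans (LM _) _; have := rnorm_ge0 (z - y); have := ler_norm M.
  by move: zy; move: (rnorm _) `|M| => a b; nra.
have Lo : F \o shift x = cst (F x) + L +o_ 0 id.
  apply/eqaddoP => e /pos_toC[r r0 ->].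
  (* Below [d] the remainder estimate applies; below [r / (C + 1)] it gives [C |h|^2 <= r |h|]. *)
  apply/nbhs_rnorm; exists (Num.min d (r / (C + 1))) => [|h].
    by rewrite lt_min d0 divr_gt0 // ltr_wpDl.
  rewrite subr0 lt_min => /andP[hd]; rewrite ltr_pdivlMr ?ltr_wpDl // => hr.
  rewrite !rnormE -toCM toC_le.
  have -> : (F \o shift x - (cst (F x) + L)) h = F (x + h) - F x - L h.
    by rewrite -[LHS]/(F (h + x) - (F x + L h)) opprD addrA [h + x]addrC.
  apply: le_trans (FL (ltW hd)) _; have := rnorm_ge0 h; rewrite -/(rnorm (id h)).
  by move: hr; move: (rnorm _) => a; nra.
by apply/diff_locallyP; rewrite (diff_unique Lc Lo).
Qed.

End QuadraticRemainder.

(** * Kernel vectors *)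

Section ReproducingKernel.
Variables (R : realType) (m : nat) (q : R) (H : hilbert_completion m q).
Hypotheses (q0 : 0 < q) (q1 : q < 1).
Local Notation emb := (hc_emb H).
Local Notation dot := (@hc_dot R m q H).
Implicit Types (p : fpoly R m) (f g u v : H) (x y : Defs.point R m).
Implicit Types (S T : {set 'I_m}).

Lemma seq_cvg_prod (n : nat) (u : 'I_n -> nat -> CC R) (l : 'I_n -> CC R) :
  (forall k, seq_cvg (u k) (l k)) ->
  seq_cvg (fun N => \prod_k u k N) (\prod_k l k).
Proof.
move=> ul; elim: (index_enum 'I_n) => [|k s IH].
  by rewrite big_nil; apply: (@seq_cvg_eventually _ _ _ _ 0%N) => N _; rewrite big_nil.
rewrite big_cons; under eq_fun do rewrite big_cons.
by apply/seq_cvgP; apply: cvgM; apply/seq_cvgP.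
Qed.

Lemma dotBr u v f : dot f (u - v) = dot f u - dot f v.
Proof. by rewrite -scaleN1r addrC dotPr rmorphN1 mulN1r addrC. Qed.

Lemma dot_sumr (I : Type) (s : seq I) (F : I -> H) (c : I -> CC R) f :
  dot f (\sum_(i <- s) c i *: F i) = \sum_(i <- s) (c i)^* * dot f (F i).
Proof.
elim: s => [|i s IH]; last by rewrite !big_cons dotPr IH.
by rewrite !big_nil -(subrr (0 : H)) dotBr subrr.
Qed.

Lemma dot_suml (I : Type) (s : seq I) (F : I -> H) (c : I -> CC R) f :
  dot (\sum_(i <- s) c i *: F i) f = \sum_(i <- s) c i * dot (F i) f.
Proof.
elim: s => [|i s IH]; last by rewrite !big_cons dotPl IH.
by rewrite !big_nil dot0l.
Qed.

(** The squared norm of the truncated kernel vector at [x], the same for every [S] (see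
    [jf_dot_kpoly_self]). *)
Definition kmajor x N : R := \prod_k rqexp q (rnorm (coord x k) * rnorm (coord x k)) N.

Lemma rqexp_ge0 (r : R) N : 0 <= r -> 0 <= rqexp q r N.
Proof. by move=> r0; apply: sumr_ge0 => n _; exact: rqexp_term_ge0. Qed.

Lemma kmajor_homo x : {homo kmajor x : n k / (n <= k)%N >-> n <= k}.
Proof.
move=> n k nk; apply: ler_prod => l _.
by rewrite rqexp_ge0 ?rqexp_homo ?mulr_ge0 ?rnorm_ge0.
Qed.

Lemma kmajor_bounded x : Omega q x -> exists M, forall N, kmajor x N <= M.
Proof.
move=> xO.
have [M MP] := choice (fun k => rqexp_bounded q0 q1
  (mulr_ge0 (rnorm_ge0 (coord x k)) (rnorm_ge0 (coord x k))) (Omega_prod q1 k xO xO)).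
exists (\prod_k M k) => N; apply: ler_prod => k _.
by rewrite rqexp_ge0 ?MP ?mulr_ge0 ?rnorm_ge0.
Qed.

Lemma jf_dot_kpoly_self N N' S x : (N <= N')%N ->
  jf_dot q (kpoly q N S x) (kpoly q N' S x) = toC (kmajor x N).
Proof.
move=> NN; rewrite jf_dot_kpoly2 // eqxx /kmajor toC_prod; apply: eq_bigr => k _.
rewrite conj_norm2 /cqexp /rqexp toC_sum; apply: eq_bigr => n _.
by rewrite toCM toCV !toCX toCM expr2.
Qed.

(** Pythagoras: both mixed products equal the squared norm of the shorter truncation. *)
Lemma kpoly_diff N N' S x : (N <= N')%N ->
  rnorm (emb (kpoly q N' S x) - emb (kpoly q N S x)) ^+ 2 = kmajor x N' - kmajor x N.
Proof.
move=> NN; apply: toC_inj; rewrite -dot_norm2 dotBl !dotBr.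
rewrite [dot (emb (kpoly q N' S x)) (emb (kpoly q N S x))]dotC !hc_isom.
rewrite !jf_dot_kpoly_self // toC_conj subrr subr0 toCD toCN.
by [].
Qed.

Lemma kpoly_cauchy S x : Omega q x -> seq_cauchy (fun N => emb (kpoly q N S x)).
Proof.
move=> xO e e0; have [M MP] := kmajor_bounded xO.
have [|N NP] := monotone_cauchy (@kmajor_homo x) MP (e := e ^+ 2).
  by rewrite exprn_gt0.
have Q n k : (N <= n)%N -> (n <= k)%N ->
    rnorm (emb (kpoly q k S x) - emb (kpoly q n S x)) < e.
  move=> Nn nk; rewrite -(@ltr_pXn2r _ 2) ?nnegrE ?rnorm_ge0 ?(ltW e0) //.
  by rewrite kpoly_diff // NP.
exists N => n k Nn Nk; case/orP: (leq_total n k) => nk; last exact: Q.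
by rewrite rnormB Q.
Qed.

Definition kvec S x : H := xget 0 (seq_cvg (fun N => emb (kpoly q N S x))).

Lemma kvecP S x : Omega q x -> seq_cvg (fun N => emb (kpoly q N S x)) (kvec S x).
Proof.
move=> xO; have [l lP] := complete_seq_complete (kpoly_cauchy S xO).
exact: (@xgetPex _ 0 _ (ex_intro _ l lP)).
Qed.

Lemma dot_emb_kvec p S x : Omega q x -> dot (emb p) (kvec S x) = peval p x S.
Proof.
move=> xO; apply: seq_cvg_unique (seq_cvg_dotr (emb p) (kvecP S xO)) _.
have [N0 NP] := jf_dot_kpoly_peval q0 q1 p S x.
by apply: (@seq_cvg_eventually _ _ _ _ N0) => N /NP; rewrite hc_isom.
Qed.

Lemma KqE x y : Kq q x y = \prod_k qexp q (coord x k * (coord y k)^*).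
Proof.
rewrite /Kq; move: (@qexp R q) => E.
transitivity ((\prod_(i < m) E (x.1 0 i * (y.1 0 i)^*)) *
  (\prod_(i < m) E (x.2 0 i * (y.2 0 i)^*))); first exact: big_split.
rewrite big_split_ord; congr (_ * _); apply: eq_bigr => i _.
  by rewrite /coord !row_mxEl.
by rewrite /coord !row_mxEr.
Qed.

Lemma dot_kvec S T x y : Omega q x -> Omega q y ->
  dot (kvec S x) (kvec T y) = if S == T then Kq q y x else 0.
Proof.
move=> xO yO; apply: seq_cvg_unique (seq_cvg_dotl (kvec T y) (kvecP S xO)) _.
(* The iterated limit is harmless: with [N] fixed, the products are constant in the second index
   from [N] on. *)
have E N : dot (emb (kpoly q N S x)) (kvec T y) =
    if S == T then \prod_k cqexp q (coord y k * (coord x k)^*) N else 0.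
  apply: seq_cvg_unique (seq_cvg_dotr (emb (kpoly q N S x)) (kvecP T yO)) _.
  apply: (@seq_cvg_eventually _ _ _ _ N) => N' NN.
  by rewrite hc_isom jf_dot_kpoly2.
under eq_fun do rewrite E.
case: ifP => _; last exact: (@seq_cvg_eventually _ _ _ _ 0%N).
rewrite KqE; apply: seq_cvg_prod => k; apply: cqexp_cvg => //.
by rewrite rnormM rnorm_conj; exact: Omega_prod.
Qed.

Definition evaluation f x : extalg R m := [ffun S => dot f (kvec S x)].

Lemma evaluation_reproducing y (v : extalg R m) : Omega q y -> exists k : H,
  (forall x, Omega q x -> evaluation k x = Kq q x y *: v) /\
  (forall f, dot f k = ext_dot (evaluation f y) v).
Proof.
(* In the first argument of the form the coefficients [v S] come out as they are, which gives
   [Kq q x y *: v]; in the second they come out conjugated, as in [ext_dot]. *)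
move=> yO; exists (\sum_(S : {set 'I_m}) v S *: kvec S y); split => [x xO|f].
  apply/ffunP => T; rewrite [LHS]ffunE dot_suml (bigD1 T) //= dot_kvec // eqxx.
  rewrite big1 ?addr0 => [|S ST]; last by rewrite dot_kvec // (negPf ST) mulr0.
  by rewrite ffunE mulrC.
rewrite dot_sumr /ext_dot; apply: eq_bigr => S _.
by rewrite ffunE mulrC.
Qed.

(** Kept as a predicate on plain functions, so that combinations such as [fun f => c * F f + G f]
    need no bundling. *)
Definition bounded_form (F : H -> CC R) : Prop :=
  (forall c f g, F (c *: f + g) = c * F f + F g) /\
  exists2 M, 0 <= M & forall f, rnorm (F f) <= M * rnorm f.

Lemma bounded_form_dot u : bounded_form (dot ^~ u).
Proof.
split=> [c f g|]; first exact: dotPl.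
by exists (rnorm u) => [|f]; [exact: rnorm_ge0 | rewrite mulrC dot_le].
Qed.

Lemma bounded_form_lin c F G : bounded_form F -> bounded_form G ->
  bounded_form (fun f => c * F f + G f).
Proof.
move=> [Fl [M M0 FM]] [Gl [N N0 GN]]; split=> [d f g|].
  by rewrite Fl Gl !mulrDr mulrCA addrACA.
exists (rnorm c * M + N) => [|f]; first by rewrite addr_ge0 ?mulr_ge0 ?rnorm_ge0.
apply: le_trans (rnormD _ _) _; rewrite rnormM mulrDl -mulrA lerD // ler_wpM2l //.
exact: rnorm_ge0.
Qed.

Lemma bounded_form0 : bounded_form (fun=> 0).
Proof.
split=> [c f g|]; first by rewrite mulr0 addr0.
by exists 0 => // f; rewrite rnorm0 mul0r.
Qed.

Lemma bounded_form_sum (n : nat) (c : 'I_n -> CC R) (F : 'I_n -> H -> CC R) :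
  (forall k, bounded_form (F k)) -> bounded_form (fun f => \sum_k c k * F k f).
Proof.
move=> Fb; elim: (index_enum 'I_n) => [|k s IH].
  by under eq_fun do rewrite big_nil; exact: bounded_form0.
by under eq_fun do rewrite big_cons; exact: bounded_form_lin.
Qed.

(** The a priori bound [M] only provides continuity and disappears in the limit, while the constant
    [C] found on polynomials survives. *)
Lemma bounded_form_le F (C : R) : bounded_form F -> 0 <= C ->
  (forall p, rnorm (F (emb p)) <= C * rnorm (emb p)) ->
  forall f, rnorm (F f) <= C * rnorm f.
Proof.
move=> [Fl [M M0 FM]] C0 FC f; apply/ler_addgt0Pr => e e0.
have MC : 0 < M + C + 1 by rewrite ltr_wpDl // addr_ge0.
(* Replacing [f] by [emb p] costs at most [M + C] times their distance: once for [F (emb p - f)],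
   once for the norm of [emb p]. *)
have [|p pf] := @emb_approx _ _ _ H f (e / (M + C + 1)); first by rewrite divr_gt0.
have {1}-> : f = (-1) *: (emb p - f) + emb p.
  by rewrite scaleN1r opprB subrK.
rewrite Fl mulN1r; apply: le_trans (rnormD _ _) _; rewrite rnormN.
have h1 := FM (emb p - f); have h2 := FC p.
have h3 : rnorm (emb p) <= rnorm (emb p - f) + rnorm f.
  by have := rnormD (emb p - f) f; rewrite subrK.
rewrite ltr_pdivlMr // in pf; have := rnorm_ge0 (emb p - f).
move: pf h1 h2 h3; move: (rnorm (F (emb p - f))) (rnorm (F (emb p))).
move: (rnorm (emb p - f)) (rnorm (emb p)) (rnorm f) => a b c A B.
nra.
Qed.

(** The difference satisfies the preceding estimate with constant 0. *)
Lemma bounded_form_eq F G : bounded_form F -> bounded_form G ->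
  (forall p, F (emb p) = G (emb p)) -> F =1 G.
Proof.
move=> Fb Gb FG f; apply/eqP; rewrite -subr_eq0; apply/eqP.
have := bounded_form_le (bounded_form_lin (-1) Gb Fb) (lexx 0) _ f.
rewrite mul0r mulN1r addrC => h; apply: rnorm_eq0; apply: h => p.
by rewrite FG mulN1r addNr rnorm0 mul0r.
Qed.

Lemma bounded_form_comp F (A : {linear H -> H}) (M : R) : bounded_form F ->
  (forall f, `|A f| <= toC M * `|f|) -> bounded_form (F \o A).
Proof.
move=> [Fl [N N0 FN]] AM; split=> [c f g|]; first by rewrite /= linearP Fl.
exists (N * `|M|) => [|f]; first by rewrite mulr_ge0.
apply: le_trans (FN _) _; rewrite -mulrA ler_wpM2l //.
apply: (@le_trans _ _ (M * rnorm f)); first by rewrite -toC_le toCM -!rnormE.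
by rewrite ler_wpM2r ?rnorm_ge0 ?ler_norm.
Qed.

Lemma orth_emb_eq0 f : (forall i : bidx m, dot f (emb (bmono R i)) = 0) -> f = 0.
Proof.
move=> fb; apply: rnorm_eq0; suff : rnorm f ^+ 2 <= 0.
  by rewrite -[leRHS](expr0n R 2) ler_pXn2r ?nnegrE ?rnorm_ge0.
have fE : dot f f = 0.
  have /(_ f) h : dot^~ f =1 (fun=> 0).
    apply: bounded_form_eq; [exact: bounded_form_dot|exact: bounded_form0|move=> p].
    rewrite dotC (fpoly_bmono p) raddf_sum -[X in dot f X]/(\sum_(i <- bsupp p) emb (bcoef p i *: bmono R i)).
    under eq_bigr do rewrite linearZ.
    by rewrite dot_sumr big1 ?conjC0 // => i _; rewrite fb mulr0.
  exact: h.
by move: fE; rewrite dot_norm2 -toC0 => /toC_inj ->.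
Qed.

End ReproducingKernel.

(** * Holomorphy *)

Section Points.
Variables (R : realType) (m : nat).
Implicit Types (x y : Defs.point R m).

Definition pt_of (c : 'I_(m + m) -> CC R) : Defs.point R m :=
  (\row_i c (lshift m i), \row_i c (rshift m i)).

Lemma coord_pt_of c k : coord (pt_of c) k = c k.
Proof.
rewrite /coord /pt_of /= -(splitK k); case: (fintype.split k) => i /=.
  by rewrite row_mxEl mxE.
by rewrite row_mxEr mxE.
Qed.

Lemma coord_lin (c : CC R) x y k : coord (c *: x + y) k = c * coord x k + coord y k.
Proof.
rewrite /coord -(splitK k); case: (fintype.split k) => i /=.
  by rewrite !row_mxEl !mxE.
by rewrite !row_mxEr !mxE.
Qed.

Lemma coordD x y k : coord (x + y) k = coord x k + coord y k.
Proof. by rewrite -[x]scale1r coord_lin mul1r scale1r. Qed.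

Lemma coord0 k : coord (0 : Defs.point R m) k = 0.
Proof. by rewrite -(subrr (0 : Defs.point R m)) -scaleN1r addrC coord_lin mulN1r addNr. Qed.

(** Balls of pairs and of matrices are componentwise, so the bound is read off the balls of radius
    slightly above the norm. *)
Lemma rnorm_coord_le x k : rnorm (coord x k) <= rnorm x.
Proof.
apply/ler_addgt0Pr => e e0.
have [h1 h2] : ball (0 : Defs.point R m) (toC (rnorm x + e)) x.
  by rewrite -ball_normE /= sub0r normrN rnormE toC_lt ltrDl.
have entry (z : 'rV[CC R]_m) : ball (0 : 'rV[CC R]_m) (toC (rnorm x + e)) z ->
    forall i, rnorm (z 0 i) < rnorm x + e.
  move=> [_ z0] i; have := z0 0 i; rewrite mxE -ball_normE /= sub0r normrN rnormE toC_lt; exact.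
have {}h1 := entry _ h1; have {}h2 := entry _ h2.
rewrite /coord -(splitK k); case: (fintype.split k) => i /=.
  by rewrite row_mxEl ltW.
by rewrite row_mxEr ltW.
Qed.

End Points.

Section Holomorphy.
Variables (R : realType) (m : nat) (q : R) (H : hilbert_completion m q).
Hypotheses (q0 : 0 < q) (q1 : q < 1).
Local Notation emb := (hc_emb H).
Local Notation dot := (@hc_dot R m q H).
Local Notation kvec := (@kvec R m q H).
Implicit Types (p : fpoly R m) (f g u v : H) (x y h : Defs.point R m).
Implicit Types (S : {set 'I_m}).

(* Replacing every coefficient by its modulus keeps the norm and turns
   evaluation at [r] into the sum of the moduli of the terms. *)
Lemma peval_majorant p S (r : 'I_(m + m) -> R) : (forall k, 0 <= r k < radius q) ->
  \sum_(a <- msupp (p S)) rnorm (mcoeff a (p S)) * \prod_k r k ^+ a k <=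
  rnorm (kvec S (pt_of (fun k => toC (r k)))) * rnorm (emb p).
Proof.
move=> rP; pose x := pt_of (fun k => toC (r k)).
have xO : Omega q x.
  by apply/OmegaP => // k; have /andP[r0 r1] := rP k; rewrite coord_pt_of rnorm_toC.
pose p' : fpoly R m := \sum_(i <- bsupp p) toC (rnorm (bcoef p i)) *: bmono R i.
have p'E i : bcoef p' i = toC (rnorm (bcoef p i)).
  rewrite bcoef_sum ?bsupp_uniq //; case: ifPn => //.
  by rewrite mem_bsupp negbK => /eqP ->; rewrite rnorm0 toC0.
have pp' : rnorm (emb p') = rnorm (emb p).
  apply/eqP; rewrite -(@eqrXn2 _ 2) ?rnorm_ge0 // !rnorm_emb2; apply/eqP.
  apply: toC_inj; rewrite -!jf_dot_norm2.
  rewrite !(@jf_dotE _ _ _ (bsupp p)) ?bsupp_uniq //; first last.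
  - by move=> i; rewrite mem_bsupp negbK p'E => /eqP ->; rewrite rnorm0 toC0.
  - by move=> i; rewrite mem_bsupp negbK => /eqP.
  apply: eq_bigr => i _; rewrite p'E toC_conj conj_norm2.
  by rewrite -toCM -expr2.
have := dot_le (emb p') (kvec S x); rewrite pp' mulrC; apply: le_trans.
rewrite dot_emb_kvec // peval_sum.
have E : \sum_(a <- msupp (p' S)) bcoef p' (S, a) * monom x a =
    toC (\sum_(a <- msupp (p S)) rnorm (mcoeff a (p S)) * \prod_k r k ^+ a k).
  rewrite (@sum_eq_supp _ _ _ (msupp (p S))) ?msupp_uniq //; first last.
  - by move=> a _ ap'; rewrite /bcoef /= (memN_msupp_eq0 ap') mul0r.
  - move=> a _ ap; rewrite p'E /bcoef /= (memN_msupp_eq0 ap).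
    by rewrite rnorm0 toC0 mul0r.
  rewrite toC_sum; apply: eq_bigr => a _; rewrite p'E toCM /monom toC_prod.
  by congr (_ * _); apply: eq_bigr => k _; rewrite coord_pt_of toCX.
by rewrite E rnorm_toCE ler_norm.
Qed.

Section AtPoint.
Variables (x : Defs.point R m) (S : {set 'I_m}) (d : R).
Hypotheses (d0 : 0 < d) (xd : forall k, rnorm (coord x k) + d < radius q).

(** The majorant constant at the point with coordinates [|x_k| + d], which [xd] keeps in [Omega q]:
    one constant for all polynomials, increments and weights [T]. *)
Let C := rnorm (kvec S (pt_of (fun k => toC (rnorm (coord x k) + d)))).

Let C0 : 0 <= C. Proof. exact: rnorm_ge0. Qed.

Let OmegaD h : (forall k, rnorm (coord h k) <= d) -> Omega q (x + h).
Proof.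
move=> hd; apply/OmegaP => // k; rewrite coordD; apply: le_lt_trans (xd k).
by apply: le_trans (rnormD _ _) _; rewrite lerD2l.
Qed.

Let Omegax : Omega q x.
Proof.
apply/OmegaP => // k; apply: lt_trans (xd k); by rewrite ltrDl.
Qed.

Let jet_emb (h : 'I_(m + m) -> CC R) (T : R) p : 1 <= T ->
  (forall k, T * rnorm (h k) <= d) ->
  jet_norm (coord x) h T (p S) <= C * rnorm (emb p).
Proof.
move=> T1 hd.
apply: le_trans (@jet_norm_le R _ _ _ _ T1 (fun k => rnorm (coord x k) + d) _ _) _.
  by move=> k; rewrite lerD2l.
by apply: peval_majorant => k; rewrite xd addr_ge0 ?rnorm_ge0 ?(ltW d0).
Qed.

Let deriv k p : CC R := meval (coord x) (mderiv k (p S)).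

Let deriv_lin k : linear (deriv k).
Proof.
by move=> c p p'; rewrite /deriv !ffunE mderivD mderivZ mevalD mevalZ.
Qed.

Let deriv_le k p : rnorm (deriv k p) <= d^-1 * C * rnorm (emb p).
Proof.
(* A Cauchy estimate: for the increment [d] in direction [k] with [T = 1], the linear part of the
   jet is [d] times the partial derivative. *)
pose h (l : 'I_(m + m)) : CC R := if l == k then toC d else 0.
have hd l : 1 * rnorm (h l) <= d.
  by rewrite mul1r /h; case: ifP => _; rewrite ?rnorm_toC ?rnorm0 ?(ltW d0).
have := jet_emb p (lexx 1) hd.
have j1 : jet1 (coord x) h (p S) = toC d * deriv k p.
  rewrite /jet1 (bigD1 k) //= big1 ?addr0 => [|l /negPf lk].
    by rewrite /h eqxx.
  by rewrite /h lk mul0r.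
rewrite /jet_norm j1 mul1r expr1n mul1r rnormM rnorm_toC ?(ltW d0) // => h1.
rewrite -mulrA mulrC ler_pdivlMr // mulrC; apply: le_trans h1.
by rewrite -addrA addrCA lerDl addr_ge0 ?rnorm_ge0.
Qed.

(** The numbers [l k] are values at [f] of the bounded extensions of the partial derivatives at [x].
    For fixed [h] the remainder is a bounded functional, so its bound on polynomials extends to
    [f]. *)
Lemma evaluation_taylor f : exists l : 'I_(m + m) -> CC R, forall (h : Defs.point R m) (T : R),
  1 <= T -> (forall k, T * rnorm (coord h k) <= d) ->
  T ^+ 2 * rnorm (dot f (kvec S (x + h)) - dot f (kvec S x) - \sum_k coord h k * l k) <=
  C * rnorm f.
Proof.
have K0 : 0 <= d^-1 * C by rewrite mulr_ge0 ?invr_ge0 ?(ltW d0).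
have ell k : exists Phi : {linear H -> CC R},
    (forall f, rnorm (Phi f) <= d^-1 * C * rnorm f) /\ (forall p, Phi (emb p) = deriv k p).
  exact: (extend_exists (@CC_seq_complete R) (@deriv_lin k) K0 (@deriv_le k)).
have [l lP] := choice ell; exists (fun k => l k f) => h T T1 hd.
have T0 : 0 <= T by apply: le_trans T1.
have hd' k : rnorm (coord h k) <= d.
  by apply: le_trans (hd k); rewrite ler_peMl ?rnorm_ge0.
pose F g : CC R := dot g (kvec S (x + h)) - dot g (kvec S x) - \sum_k coord h k * l k g.
have Fb : bounded_form F.
  have -> : F = fun g => (-1) * (\sum_k coord h k * l k g) +
      ((-1) * dot g (kvec S x) + dot g (kvec S (x + h))).
    by apply/funext => g; rewrite /F !mulN1r [RHS]addrC; congr (_ + _); rewrite addrC.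
  apply: bounded_form_lin; last by apply: bounded_form_lin; exact: bounded_form_dot.
  apply: bounded_form_sum => k; split; last by exists (d^-1 * C) => //; have [] := lP k.
  by move=> c g g'; rewrite linearP.
(* [T ^+ 2] moves to the right so that [bounded_form_le] applies with constant [C / T ^+ 2]; on
   polynomials it is moved back. *)
rewrite mulrC -ler_pdivlMr; last by rewrite exprn_gt0 // (lt_le_trans ltr01).
rewrite mulrAC; apply: (bounded_form_le Fb) => [|p].
  by rewrite divr_ge0 ?sqr_ge0.
rewrite mulrAC ler_pdivlMr; last by rewrite exprn_gt0 // (lt_le_trans ltr01).
rewrite mulrC; apply: le_trans (jet_emb p T1 hd).
have -> : F (emb p) = jet2 (coord x) (coord h) (p S).
  have e1 := dot_emb_kvec H q0 q1 p S (OmegaD hd').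
  have e2 := dot_emb_kvec H q0 q1 p S Omegax.
  transitivity (peval p (x + h) S - peval p x S - \sum_k coord h k * deriv k p).
    apply: (f_equal2 (fun a b => a - b)); first exact: (f_equal2 (fun a b => a - b) e1 e2).
    by apply: eq_bigr => k _; have [_ ->] := lP k.
  rewrite /jet2 /jet0 /jet1; congr (_ - _ - _); rewrite ffunE //.
  by apply: meval_eq => k; exact: coordD.
by rewrite /jet_norm lerDr addr_ge0 ?mulr_ge0 ?rnorm_ge0.
Qed.

End AtPoint.

Lemma Omega_margin x : Omega q x -> exists2 d : R, 0 < d &
  forall k, rnorm (coord x k) + d < radius q.
Proof.
move=> /OmegaP xO.
have [d [d0 dP]] : exists d : R, 0 < d /\ forall k, k \in index_enum 'I_(m + m) ->
    d < radius q - rnorm (coord x k).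
  elim: (index_enum _) => [|k s [d [d0 dP]]]; first by exists 1.
  have xk : 0 < radius q - rnorm (coord x k) by rewrite subr_gt0 xO.
  exists (Num.min d ((radius q - rnorm (coord x k)) / 2)); split.
    by rewrite lt_min d0 divr_gt0.
  move=> l; rewrite inE => /predU1P[->|ls].
    by rewrite gt_min; apply/orP; right; rewrite ltr_pdivrMr // ltr_pMr // ltr1n.
  by rewrite gt_min dP.
by exists d => // k; rewrite addrC -ltrBrDr dP // mem_index_enum.
Qed.

Lemma evaluation_holomorphic f : holomorphic_on (Omega q) (evaluation f).
Proof.
move=> S x xO; have [d d0 xd] := Omega_margin xO.
have [l lP] := evaluation_taylor S d0 xd f.
set C := rnorm (kvec S _) in lP.
have -> : (fun y => evaluation f y S) = (fun y => dot f (kvec S y)).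
  by apply/funext => y; rewrite ffunE.
pose L h : CC R := \sum_k coord h k * l k.
have Ll : linear L.
  move=> c h h'; rewrite /L scaler_sumr -big_split; apply: eq_bigr => k _ /=.
  by rewrite coord_lin mulrDl -mulrA.
have LM h : rnorm (linear_pack Ll h) <= (\sum_k rnorm (l k)) * rnorm h.
  rewrite mulr_suml; apply: le_trans (rnorm_sum _ _ _) _; apply: ler_sum => k _.
  by rewrite rnormM mulrC ler_wpM2l ?rnorm_ge0 ?rnorm_coord_le.
have K0 : 0 <= C * rnorm f / d ^+ 2.
  apply: divr_ge0; last exact: sqr_ge0.
  by apply: mulr_ge0; exact: rnorm_ge0.
apply: (@differentiable_quadratic _ _ _ x (linear_pack Ll) _ (C * rnorm f / d ^+ 2) d LM) => //.
move=> h hd; have [h0|hn0] := eqVneq h 0.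
  have -> : linear_pack Ll h = 0 by rewrite h0 linear0.
  by rewrite h0 addr0 !subrr !rnorm0 mulr_ge0 ?sqr_ge0.
have hp : 0 < rnorm h.
  rewrite lt_neqAle rnorm_ge0 andbT eq_sym.
  by apply: contraNneq hn0 => h0; apply/eqP/rnorm_eq0; rewrite h0.
(* This weight is at least 1 because [h] has norm at most [d], and it scales every coordinate of [h]
   to modulus at most [d]. Its square supplies the factor [|h|^2 / d^2]; the quotient is why [h = 0]
   was split off. *)
have := lP h (d / rnorm h); rewrite ler_pdivlMr // mul1r => /(_ hd) h1.
have {h1} := h1 _; rewrite -[\sum_k _]/(linear_pack Ll h).
move: (rnorm (_ - _ - _)) => A h1.
have {}h1 : (d / rnorm h) ^+ 2 * A <= C * rnorm f.
  by apply: h1 => k; rewrite mulrAC ler_pdivrMr // ler_wpM2l ?rnorm_coord_le // ltW.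
rewrite mulrAC ler_pdivlMr ?exprn_gt0 // mulrC.
have -> : d ^+ 2 = (d / rnorm h) ^+ 2 * rnorm h ^+ 2.
  by rewrite -exprMn divfK // gt_eqF.
by rewrite mulrAC ler_wpM2r ?sqr_ge0.
Qed.

End Holomorphy.

(** * Elements are determined by their values *)

Section Uniqueness.
Variables (R : realType) (m : nat) (q : R) (H : hilbert_completion m q).
Hypotheses (q0 : 0 < q) (q1 : q < 1).
Local Notation emb := (hc_emb H).
Local Notation dot := (@hc_dot R m q H).
Local Notation kvec := (@kvec R m q H).
Implicit Types (p : fpoly R m) (f g : H) (x y : Defs.point R m) (S : {set 'I_m}).

Definition dilate_pt (k : 'I_(m + m)) x : Defs.point R m :=
  pt_of (fun l => if l == k then toC q * coord x l else coord x l).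

Lemma dilate_pt_Omega k x : Omega q x -> Omega q (dilate_pt k x).
Proof.
move=> /OmegaP xO; apply/OmegaP => // l; rewrite coord_pt_of; case: ifP => // _.
rewrite rnormM rnorm_toC ?ltW //; apply: le_lt_trans (xO l).
by rewrite ler_piMl ?rnorm_ge0 // ltW.
Qed.

(** The q-difference formula with its denominator cleared, hence valid also where [v k] vanishes. *)
Lemma meval_qderiv (n : nat) (k : 'I_n) (v : 'I_n -> CC R) (s : mpoly n (CC R)) :
  toC (q - 1) * v k * meval v (qderiv q k s) =
  meval (fun l => if l == k then toC q * v l else v l) s - meval v s.
Proof.
have -> : toC (q - 1) * v k * meval v (qderiv q k s) =
    meval v (toC (q - 1) *: (mpolyX (CC R) (mnm1 k) * qderiv q k s)).
  by rewrite mevalZ mevalM mevalXU mulrA.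
have -> : toC (q - 1) *: (mpolyX (CC R) (mnm1 k) * qderiv q k s) = dilate q k s - s.
  apply/mpolyP => a; rewrite mcoeffZ mcoeffB mcoeff_dilate mcoeffXmul.
  case: (posnP (a k)) => [->|ak]; first by rewrite mulr0 expr0 mul1r subrr.
  rewrite mcoeff_qderiv // mnmBE mnm1E eqxx subn1 prednK //.
  rewrite mnm_subK -?lt0n //.
  rewrite mulrA -toCM; have -> : (q - 1) * qnat q (a k) = q ^+ a k - 1.
    rewrite /qnat mulrCA -[q - 1]opprB mulNr divff ?gt_eqF ?subr_gt0 //.
    by rewrite mulrN1 opprB.
  by rewrite toCD toCN toC1 toCX mulrBl mul1r.
rewrite mevalB comp_mpoly_meval; congr (_ - _); apply: meval_eq => l.
by rewrite tnth_mktuple; case: ifP => _; rewrite ?mevalZ mevalXU.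
Qed.

Lemma dot_qderiv_kvec (D : {linear H -> H}) k f S x :
  bounded_extension (coefw (qderiv q k)) D -> Omega q x ->
  toC (q - 1) * coord x k * dot (D f) (kvec S x) =
  dot f (kvec S (dilate_pt k x)) - dot f (kvec S x).
Proof.
move=> [[M DM] DE] xO; pose c := toC (q - 1) * coord x k.
have b1 := bounded_form_lin c (bounded_form_comp (bounded_form_dot (kvec S x)) DM) (bounded_form0 H).
have b2 := bounded_form_lin (-1) (bounded_form_dot (kvec S x)) (bounded_form_dot (kvec S (dilate_pt k x))).
have := bounded_form_eq b1 b2 _ f; rewrite /= addr0 mulN1r [X in _ -> _ = X]addrC; apply.
move=> p; rewrite addr0 DE mulN1r [RHS]addrC.
transitivity (c * peval (coefw (qderiv q k) p) x S).
  exact: (congr1 (fun a => c * a) (dot_emb_kvec H q0 q1 _ S xO)).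
transitivity (peval p (dilate_pt k x) S - peval p x S); last first.
  exact: (esym (f_equal2 (fun a b => a - b) (dot_emb_kvec H q0 q1 p S (dilate_pt_Omega k xO))
    (dot_emb_kvec H q0 q1 p S xO))).
rewrite [peval (coefw _ _) _ _]ffunE [coefw _ _ _]ffunE /c meval_qderiv.
congr (_ - _); rewrite ffunE //; apply: meval_eq => l.
by rewrite -[RHS]/(coord (dilate_pt k x) l) coord_pt_of.
Qed.

(** Adjointness with multiplication by the variable: the q-number produced by the q-derivative is
    exactly the ratio of the weights of the two monomials. *)
Lemma dot_qderiv_bmono (D : {linear H -> H}) k f S a :
  bounded_extension (coefw (qderiv q k)) D ->
  dot (D f) (emb (bmono R (S, a))) = dot f (emb (bmono R (S, mnm_add a (mnm1 k)))).
Proof.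
move=> [[M DM] DE].
have b1 := bounded_form_comp (bounded_form_dot (emb (bmono R (S, a)))) DM.
have b2 := bounded_form_dot (emb (bmono R (S, mnm_add a (mnm1 k)))).
apply: (bounded_form_eq b1 b2) => p; rewrite /= DE !hc_isom !jf_dot_bmono //=.
by rewrite /bcoef /= ffunE mcoeff_qderiv // jf_weightD // toCM mulrCA mulrA.
Qed.

Lemma Omega_origin : Omega q (0 : Defs.point R m).
Proof. by apply/OmegaP => // k; rewrite coord0 rnorm0 radius_gt0. Qed.

(** At the origin every monomial except the constant one vanishes, and the constant one has weight
    1. This is the base case of [kvec_total]. *)
Lemma kvec_origin S f : dot f (kvec S 0) = dot f (emb (bmono R (S, @mnm0 (m + m)))).
Proof.
have O0 := Omega_origin.
apply: (bounded_form_eq (bounded_form_dot _) (bounded_form_dot _)) => p.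
rewrite hc_isom jf_dot_bmono // dot_emb_kvec // jf_weightE big1 => [|k _]; last first.
  by rewrite mnm0E qfact0.
rewrite toC1 mulr1 peval_sum.
have E a : bcoef p (S, a) * monom (0 : Defs.point R m) a =
    bcoef p (S, a) * (a == @mnm0 (m + m))%:R.
  congr (_ * _); case: eqP => [->|/eqP a0].
    by rewrite /monom big1 // => k _; rewrite mnm0E expr0.
  have [k ak] := mnm_neq0 a0.
  by rewrite /monom (bigD1 k) //= coord0 expr0n (negPf ak) mul0r.
rewrite (eq_bigr _ (fun a _ => E a)) sum_delta ?msupp_uniq //.
by case: ifPn => // h; rewrite /bcoef /= (memN_msupp_eq0 h).
Qed.

(* At points where the k-th coordinate vanishes the q-difference quotient says
   nothing, and continuity is used instead. *)
Lemma kvec_orth_shift (D : {linear H -> H}) k f :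
  bounded_extension (coefw (qderiv q k)) D ->
  (forall S x, Omega q x -> dot f (kvec S x) = 0) ->
  forall S x, Omega q x -> dot (D f) (kvec S x) = 0.
Proof.
move=> DE f0 S x xO.
have nz y : Omega q y -> coord y k != 0 -> dot (D f) (kvec S y) = 0.
  move=> yO yk.
  have := etrans (dot_qderiv_kvec f S DE yO) (etrans (f_equal2 (fun a b => a - b)
    (f0 S _ (dilate_pt_Omega k yO)) (f0 S _ yO)) (subrr 0)).
  move/eqP; rewrite mulf_eq0 mulf_eq0 (negPf yk) orbF => /orP[|/eqP //].
  by rewrite -toC0 (inj_eq (@toC_inj R)) subr_eq0 lt_eqF.
have [xk|/nz] := eqVneq (coord x k) 0; last exact.
have [d d0 xd] := Omega_margin xO.
pose G y := evaluation (D f) y S.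
have GE y : G y = dot (D f) (kvec S y) by rewrite /G ffunE.
have Gc : {for x, continuous G}.
  by apply: differentiable_continuous; apply: (evaluation_holomorphic q0 q1).
rewrite -GE; apply/eqP; apply: contraT => Gx.
have a0 : 0 < rnorm (G x).
  rewrite lt_neqAle rnorm_ge0 andbT eq_sym.
  by apply: contraNneq Gx => Gx; apply/eqP/rnorm_eq0; rewrite Gx.
have /nbhs_rnorm[e e0 eP] : nbhs x (G @^-1` [set z | rnorm (z - G x) < rnorm (G x)]).
  by apply: Gc; apply/nbhs_rnorm; exists (rnorm (G x)).
pose u : Defs.point R m := pt_of (fun l => (l == k)%:R).
have u1 : 0 < rnorm u + 1 by rewrite ltr_wpDl ?rnorm_ge0.
pose s := Num.min (e / (rnorm u + 1)) d.
have s0 : 0 < s by rewrite lt_min d0 divr_gt0.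
have cs l : coord (toC s *: u + x) l = toC s * (l == k)%:R + coord x l.
  by rewrite coord_lin coord_pt_of.
have yO : Omega q (toC s *: u + x).
  apply/OmegaP => // l; rewrite cs; apply: le_lt_trans (rnormD _ _) _.
  apply: le_lt_trans (xd l); rewrite addrC lerD2l rnormM rnorm_toC ?(ltW s0) //.
  case: (l == k); last by rewrite rnorm0 mulr0 ltW.
  by rewrite rnorm1 mulr1 /s ge_min lexx orbT.
have yk : coord (toC s *: u + x) k != 0.
  by rewrite cs eqxx mulr1 xk addr0 -toC0 (inj_eq (@toC_inj R)) gt_eqF.
have /eP : rnorm (toC s *: u + x - x) < e.
  rewrite addrK rnormZ rnorm_toC ?(ltW s0) //.
  have : s * (rnorm u + 1) <= e by rewrite -ler_pdivlMr // /s ge_min lexx.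
  by apply: lt_le_trans; rewrite mulrDr mulr1 ltrDl.
by rewrite /= [G (_ + _)]GE (nz _ yO yk) sub0r rnormN ltxx.
Qed.

Lemma kvec_total f : (forall S x, Omega q x -> dot f (kvec S x) = 0) -> f = 0.
Proof.
move=> f0; apply: orth_emb_eq0 => -[S a].
(* [f] is generalized along with [a], since the inductive step trades a variable of the monomial for
   the passage from [f] to [D f]. *)
elim: {a}(mdeg a) {-2}a (erefl (mdeg a)) f f0 => [|n IH] a an f f0.
  have -> : a = @mnm0 (m + m) by apply/eqP; rewrite -mdeg_eq0 an.
  rewrite -kvec_origin; apply: f0; exact: Omega_origin.
have [k ak] : exists k, a k != 0%N by apply: mnm_neq0; rewrite -mdeg_eq0 an.
have aE := mnm_subK ak.
have [D DE] := jf_bounded_extends (jf_bounded_qderiv H q0 q1 k).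
rewrite -aE -(dot_qderiv_bmono f S _ DE); apply: IH.
  by move: an; rewrite -{1}aE mdegD mdeg1 addn1 => -[].
exact: kvec_orth_shift DE f0.
Qed.

End Uniqueness.

Theorem theorem6p4 (R : realType) (m : nat) (q : R)
    (hm : (1 <= m)%N) (hq0 : 0 < q) (hq1 : q < 1) :
  inhabited (hilbert_completion m q) /\
  forall H : hilbert_completion m q,
    is_rkhs_of_holomorphic_functions H /\
    (exists D Ddag Z Zd : {linear H -> H},
      [/\ bounded_extension (@Dq R m q) D,
          bounded_extension (@Dqdag R m q) Ddag,
          bounded_extension (@Zop R m) Z
        & bounded_extension (@Zdag R m) Zd] /\
      [/\ closed_subspace (opker D),
          closed_subspace (opker Ddag)
        & closed_subspace (opker D `&` opker Ddag)]) /\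
    (extends_boundedly H (@Apinv R m q) /\ extends_boundedly H (@Bpinv R m q)) /\
    [/\ extends_boundedly H (@Piz R m q), extends_boundedly H (@Qz R m q),
        extends_boundedly H (@Piw R m q) & extends_boundedly H (@Qw R m q)].
Proof.
split; first exact: hilbert_completion_exists.
move=> H; split.
  exists (@evaluation R m q H); split.
  - move=> x _ c f g; apply/ffunP => S; rewrite !ffunE; exact: dotPl.
  - move=> f g fg; apply/eqP; rewrite -subr_eq0; apply/eqP.
    apply: (kvec_total hq0 hq1) => S x xO; rewrite dotBl.
    by have /ffunP/(_ S) := fg x xO; rewrite !ffunE => ->; rewrite subrr.
  - by move=> p x xO; apply/ffunP => S; rewrite [LHS]ffunE (dot_emb_kvec H hq0 hq1 p S xO).
  - exact: evaluation_holomorphic.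
  - by move=> y v; exact: evaluation_reproducing.
split.
  have [D DE] := jf_bounded_extends (jf_bounded_Dq H hq0 hq1).
  have [D' D'E] := jf_bounded_extends (jf_bounded_Dqdag H hq0 hq1).
  have [Z ZE] := jf_bounded_extends (jf_bounded_Zop H hq0 hq1).
  have [Z' Z'E] := jf_bounded_extends (jf_bounded_Zdag H hq0 hq1).
  exists D, D', Z, Z'; split => //.
  have Dc : closed_subspace (opker D) by have [[M DM] _] := DE; exact: closed_subspace_ker DM.
  have D'c : closed_subspace (opker D') by have [[M DM] _] := D'E; exact: closed_subspace_ker DM.
  by split=> //; exact: closed_subspaceI.
split; first by split; apply: jf_bounded_extends; [exact: jf_bounded_Apinv|exact: jf_bounded_Bpinv].
split; apply: jf_bounded_extends.
- by apply: jf_bounded_id_sub; exact: jf_bounded_Qz.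
- exact: jf_bounded_Qz.
- by apply: jf_bounded_id_sub; exact: jf_bounded_Qw.
- exact: jf_bounded_Qw.
Qed.
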